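(* Let $H$ be a Hilbert module over a $C^*$-algebra. Suppose that $X$ is a Hilbert space and $\pi:\mathcal{L}(H)\to\mathbb{B}(X)$ is a unital $C^*$-morphism. Then $m\big(\pi(Q)\big)=\pi\big(m(Q)\big)$ for every idempotent $Q\in \mathcal{L}(H)$, where $m(\cdot)$ denotes the matched projection.
   Context: $\mathcal{L}(H)$ is the $C^*$-algebra of adjointable operators on the Hilbert $C^*$-module $H$, and $I$ is the identity operator on $H$. For a Hilbert space $X$, $\mathbb{B}(X)=\mathcal{L}(X)$ is the algebra of bounded operators, with $X$ viewed as a Hilbert $\mathbb{C}$-module, so the definition below applies to idempotents in $\mathbb{B}(X)$ too. A unital $C^*$-morphism is a unital $*$-homomorphism. $\mathcal{R}(\cdot)$ and $\mathcal{N}(\cdot)$ denote range and null space. An idempotent is $Q\in\mathcal{L}(H)$ with $Q^2=Q$; a projection is a self-adjoint idempotent. $P_{\mathcal{R}(Q)}$ is the projection of $H$ onto the (orthogonally complemented) range of $Q$. Definition of the matched projection $m(Q)$ of an idempotent $Q\in\mathcal{L}(H)$: if $Q$ is a projection, $m(Q)=Q$. Otherwise, $H=\mathcal{R}(Q)\dotplus\mathcal{N}(Q^* )$ is an orthogonal decomposition; let $U:H\to\mathcal{R}(Q)\oplus\mathcal{N}(Q^* )$ be the unitary $Uh=\binom{P_{\mathcal{R}(Q)}h}{(I-P_{\mathcal{R}(Q)})h}$, let $I_1$ be the identity on $\mathcal{R}(Q)$, let $A=(Q-P_{\mathcal{R}(Q)})|_{\mathcal{N}(Q^* )}:\mathcal{N}(Q^*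 )\to\mathcal{R}(Q)$ and $B=(AA^*+I_1)^{1/2}$, and set $$m(Q)=U^*\cdot\frac12\begin{pmatrix}(B+I_1)B^{-1} & B^{-1}A\\ A^*B^{-1} & A^*[B(B+I_1)]^{-1}A\end{pmatrix}\cdot U .$$ *)

(* Defs.v *)
From HB Require Import structures.
From mathcomp Require Import all_boot all_order all_algebra.
From mathcomp Require Import complex.
From mathcomp Require Import boolp classical_sets filter reals topology normedtype.

Set Implicit Arguments.
Unset Strict Implicit.
Unset Printing Implicit Defensive.

Import Order.TTheory GRing.Theory Num.Theory.
Import numFieldNormedType.Exports.

Local Open Scope classical_set_scope.
Local Open Scope ring_scope.
Local Open Scope complex_scope.

(** * C*-algebras

    A complex C*-algebra need not have a unit, so the product is a separate
    operation and not a MathComp ring structure. *)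

HB.mixin Record isCStarAlgebra (R : realType) A
    of CompleteNormedModule R[i] A := {
  cmul : A -> A -> A;
  cstar : A -> A;
  cmulA : associative cmul;
  cmulDl : left_distributive cmul +%R;
  cmulDr : right_distributive cmul +%R;
  cscaleAl : forall (k : R[i]) (a b : A), k *: cmul a b = cmul (k *: a) b;
  cscaleAr : forall (k : R[i]) (a b : A), k *: cmul a b = cmul a (k *: b);
  cstarK : involutive cstar;
  cstarD : {morph cstar : a b / a + b};
  cstarZ : forall (k : R[i]) (a : A), cstar (k *: a) = Num.conj k *: cstar a;
  cstarM : forall a b : A, cstar (cmul a b) = cmul (cstar b) (cstar a);
  cnormM : forall a b : A, `|cmul a b| <= `|a| * `|b|;
  cnorm_star : forall a : A, `|cmul (cstar a) a| = `|a| ^+ 2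
}.

#[short(type="cstarAlgType")]
HB.structure Definition CStarAlgebra (R : realType) :=
  {A of CompleteNormedModule R[i] A & isCStarAlgebra R A}.

Definition cpositive (R : realType) (A : cstarAlgType R) (a : A) : Prop :=
  exists b : A, a = cmul (cstar b) b.

(** The instances are on [R[i]] and not on [R[i]^o] because completeness of
    [_^o] is already keyed on [realType]. *)
Section ComplexCStar.
Variable R : realType.

HB.instance Definition _ := NormedModule.copy R[i] R[i]^o.

Let norm_Re (x : R[i]) (e : R) : `|x| < e%:C -> `|complex.Re x| < e.
Proof. by rewrite -ltcR; apply: le_lt_trans; exact: normc_ge_Re. Qed.

Let norm_Im (x : R[i]) (e : R) : `|x| < e%:C -> `|complex.Im x| < e.
Proof.
rewrite -ltcR; apply: le_lt_trans; rewrite normc_def lecR.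
by rewrite -sqrtr_sqr ler_wsqrtr // lerDr sqr_ge0.
Qed.

Let cauchy_part (p : R[i] -> R) (F : set_system R[i]) :
    (forall x y, p (x - y) = p x - p y) ->
    (forall x (e : R), `|x| < e%:C -> `|p x| < e) ->
  ProperFilter F -> cauchy F -> exists l : R, p @ F --> l.
Proof.
move=> pB pn FF Fc; apply/cvg_ex; apply: R_complete.
apply/cauchy_ballP => e e0.
have e0' : 0 < e%:C :> R[i] by rewrite -[0]/(0%:C) ltcR.
move/cauchy_ballP: Fc => /(_ _ e0') [[A B] /= [FA FB] AB].
exists (p @` A, p @` B) => /=.
  by split; [apply: filterS FA | apply: filterS FB] => x Ax /=; exists x.
move=> [u v] /= [[x Ax <-] [y By <-]].
rewrite /ball /= -pB; apply: pn.
by have := AB (x, y) (conj Ax By).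
Qed.

Let complex_complete (F : set_system R[i]) :
  ProperFilter F -> cauchy F -> cvg F.
Proof.
move=> FF Fc.
have [a Fa] := @cauchy_part _ _ (raddfB (@complex.Re R)) norm_Re FF Fc.
have [b Fb] := @cauchy_part _ _ (raddfB (@complex.Im R)) norm_Im FF Fc.
apply/cvg_ex; exists (a +i* b); apply/cvgrPdist_lt => e e0.
have [r r0 ->] : exists2 r : R, 0 < r & e = r%:C.
  case: e e0 => r i; rewrite ltcE /= => /andP[/eqP -> r0].
  by exists r.
have r20 : 0 < r / 2 by rewrite divr_gt0.
move/cvgrPdist_lt : Fa => /(_ _ r20) Fa.
move/cvgrPdist_lt : Fb => /(_ _ r20) Fb.
near=> z.
have za : `|a - complex.Re z| < r / 2 by near: z.
have zb : `|b - complex.Im z| < r / 2 by near: z.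
move: (z) za zb => [x y] /= za zb.
apply: (@le_lt_trans _ _ ((`|a - x| + `|b - y|)%:C)).
  rewrite normc_def lecR /=.
  set u := a - x; set v := b - y.
  rewrite -[leLHS]/(Num.sqrt (u ^+ 2 + v ^+ 2)).
  move: u v => u v; have uv0 : 0 <= `|u| + `|v| by rewrite addr_ge0.
  rewrite -(ger0_norm uv0) -(sqrtr_sqr (`|u| + `|v|)) ler_wsqrtr // sqrrD.
  rewrite -(real_normK (num_real u)) -(real_normK (num_real v)) addrAC lerDl.
  by rewrite mulrn_wge0 // mulr_ge0.
by rewrite ltcR [r]splitr ltrD.
Unshelve. all: by end_near. Qed.

HB.instance Definition _ := Uniform_isComplete.Build R[i] complex_complete.

Let mulC_star (a b : R[i]) : Num.conj (a * b) = Num.conj b * Num.conj a.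
Proof. by rewrite rmorphM mulrC. Qed.
Let normM_le (a b : R[i]) : `|a * b| <= `|a| * `|b|.
Proof. by rewrite normrM. Qed.
Let norm_starM (a : R[i]) : `|Num.conj a * a| = `|a| ^+ 2.
Proof. by rewrite normrM norm_conjC expr2. Qed.

HB.instance Definition _ := @isCStarAlgebra.Build R R[i]
  *%R Num.conj
  (@mulrA R[i]) (@mulrDl R[i]) (@mulrDr R[i])
  (@mulrA R[i]) (fun k a b => mulrCA k a b)
  (@conjCK R[i]) (rmorphD Num.conj) (rmorphM Num.conj)
  mulC_star normM_le norm_starM.

End ComplexCStar.

(** * Hilbert C*-modules

    Right modules, with an inner product that is linear in its second variable.
    [ipModType] does not require completeness: the notions of adjointable
    operator, square root and inverse only involve the inner product, and are
    used for submodules equipped with the restricted inner product. *)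

HB.mixin Record isInnerProductModule (R : realType) (A : cstarAlgType R) E
    of GRing.Lmodule R[i] E := {
  ract : E -> A -> E;
  ip : E -> E -> A;
  ractDl : forall x y a, ract (x + y) a = ract x a + ract y a;
  ractDr : forall x a b, ract x (a + b) = ract x a + ract x b;
  ractM : forall x a b, ract x (cmul a b) = ract (ract x a) b;
  ractZl : forall (k : R[i]) x a, ract (k *: x) a = k *: ract x a;
  ractZr : forall (k : R[i]) x a, ract x (k *: a) = k *: ract x a;
  ipDr : forall x y z, ip x (y + z) = ip x y + ip x z;
  ipZr : forall (k : R[i]) x y, ip x (k *: y) = k *: ip x y;
  ip_ract : forall x y a, ip x (ract y a) = cmul (ip x y) a;
  ip_star : forall x y, cstar (ip x y) = ip y x;
  ip_ge0 : forall x, cpositive (ip x x);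
  ip_eq0 : forall x, ip x x = 0 -> x = 0
}.

#[short(type="ipModType")]
HB.structure Definition InnerProductModule (R : realType) (A : cstarAlgType R)
  := {E of GRing.Lmodule R[i] E & isInnerProductModule R A E}.

HB.mixin Record isHilbertModule (R : realType) (A : cstarAlgType R) E
    of InnerProductModule R A E & CompleteNormedModule R[i] E := {
  norm_ip : forall x : E, `|x| ^+ 2 = `|ip x x|
}.

#[short(type="hilbertModType")]
HB.structure Definition HilbertModule (R : realType) (A : cstarAlgType R)
  := {E of InnerProductModule R A E & CompleteNormedModule R[i] E
        & isHilbertModule R A E}.

(** A Hilbert space is a Hilbert module over the complex numbers: the axioms
    force [ract x a = a *: x]. *)
Notation hilbertType R := (@hilbertModType R (R[i] : cstarAlgType R)).

Section InnerProductTheory.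
Variables (R : realType) (A : cstarAlgType R) (E : ipModType A).
Implicit Types x y z : E.

Lemma cstarN (a : A) : cstar (- a) = - cstar a.
Proof. by rewrite -scaleN1r cstarZ rmorphN rmorph1 scaleN1r. Qed.

Lemma ip0r x : ip x 0 = 0 :> A.
Proof. by rewrite -[X in ip x X](scale0r (0 : E)) ipZr scale0r. Qed.

Lemma ipNr x y : ip x (- y) = - ip x y.
Proof. by rewrite -scaleN1r ipZr scaleN1r. Qed.

Lemma ipDl x y z : ip (x + y) z = ip x z + ip y z.
Proof. by rewrite -ip_star ipDr cstarD !ip_star. Qed.

Lemma ipZl (k : R[i]) x y : ip (k *: x) y = Num.conj k *: ip x y.
Proof. by rewrite -ip_star ipZr cstarZ ip_star. Qed.

Lemma ip0l x : ip 0 x = 0 :> A.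
Proof. by rewrite -[X in ip X x](scale0r (0 : E)) ipZl rmorph0 scale0r. Qed.

Lemma ipNl x y : ip (- x) y = - ip x y.
Proof. by rewrite -ip_star ipNr cstarN ip_star. Qed.

Lemma ip_ractl x y a : ip (ract x a) y = cmul (cstar a) (ip x y).
Proof. by rewrite -ip_star ip_ract cstarM ip_star. Qed.

Lemma ip_injl x y : (forall z, ip x z = ip y z) -> x = y.
Proof.
move=> xy; apply/eqP; rewrite -subr_eq0; apply/eqP/ip_eq0.
by rewrite ipDl ipNl xy subrr.
Qed.

Lemma ip_injr x y : (forall z, ip z x = ip z y) -> x = y.
Proof. by move=> xy; apply: ip_injl => z; rewrite -ip_star xy ip_star. Qed.

End InnerProductTheory.

(** * Adjointable operators

    The adjoint is part of the data; as it is determined by the operator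
    ([adjop_ext]), it does not affect equality.  Linearity and A-linearity are
    consequences ([adjopD], [adjopZ], [adjop_ract]). *)

Record adjop (R : realType) (A : cstarAlgType R) (E F : ipModType A) := AdjOp {
  adjop_fun :> E -> F;
  adjop_adj : F -> E;
  adjopP : forall x y, ip (adjop_fun x) y = ip x (adjop_adj y)
}.

Notation "''L' ( E , F )" := (adjop E F) (at level 8, format "''L' ( E ,  F )").
Notation "''L' ( E )" := (adjop E E) (at level 8, format "''L' ( E )").

HB.instance Definition _ (R : realType) (A : cstarAlgType R)
  (E F : ipModType A) := gen_eqMixin 'L(E, F).
HB.instance Definition _ (R : realType) (A : cstarAlgType R)
  (E F : ipModType A) := gen_choiceMixin 'L(E, F).

Section AdjOp.
Variables (R : realType) (A : cstarAlgType R).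
Implicit Types E F G : ipModType A.

Lemma adjop_ext E F (S T : 'L(E, F)) : S =1 T -> S = T.
Proof.
case: S T => [s s' sP] [t t' tP] /= st.
have {}st : s = t by apply/funext.
subst t; have st' : s' = t'.
  by apply/funext => y; apply: ip_injr => x; rewrite -sP tP.
by subst t'; congr AdjOp; exact: Prop_irrelevance.
Qed.

Lemma adjopD E F (T : 'L(E, F)) x y : T (x + y) = T x + T y.
Proof. by apply: ip_injl => z; rewrite ipDl !adjopP ipDl. Qed.

Lemma adjopZ E F (T : 'L(E, F)) k x : T (k *: x) = k *: T x.
Proof. by apply: ip_injl => z; rewrite ipZl !adjopP ipZl. Qed.

Lemma adjop_ract E F (T : 'L(E, F)) x a : T (ract x a) = ract (T x) a.
Proof. by apply: ip_injl => z; rewrite ip_ractl !adjopP ip_ractl. Qed.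

Lemma adjop0 E F (T : 'L(E, F)) : T 0 = 0.
Proof. by rewrite -[X in T X](scale0r (0 : E)) adjopZ scale0r. Qed.

Lemma adjopN E F (T : 'L(E, F)) x : T (- x) = - T x.
Proof. by rewrite -scaleN1r adjopZ scaleN1r. Qed.

Lemma adjop_adjP E F (T : 'L(E, F)) x y : ip (adjop_adj T y) x = ip y (T x).
Proof. by rewrite -ip_star -adjopP ip_star. Qed.

Definition adjoint E F (T : 'L(E, F)) : 'L(F, E) := AdjOp (fun y x => adjop_adjP T x y).

Fact comp_op_subproof E F G (S : 'L(F, G)) (T : 'L(E, F)) x y :
  ip (S (T x)) y = ip x (adjop_adj T (adjop_adj S y)).
Proof. by rewrite !adjopP. Qed.
Definition comp_op E F G (S : 'L(F, G)) (T : 'L(E, F)) : 'L(E, G) :=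
  AdjOp (comp_op_subproof S T).

Fact id_op_subproof E (x y : E) : ip x y = ip x y. Proof. by []. Qed.
Definition id_op E : 'L(E) := AdjOp (@id_op_subproof E).

Fact zero_op_subproof E F (x : E) (y : F) : ip (0 : F) y = ip x (0 : E).
Proof. by rewrite ip0l ip0r. Qed.
Definition zero_op E F : 'L(E, F) := AdjOp (@zero_op_subproof E F).

Fact add_op_subproof E F (S T : 'L(E, F)) x y :
  ip (S x + T x) y = ip x (adjop_adj S y + adjop_adj T y).
Proof. by rewrite ipDl ipDr !adjopP. Qed.
Definition add_op E F (S T : 'L(E, F)) : 'L(E, F) := AdjOp (add_op_subproof S T).

Fact opp_op_subproof E F (T : 'L(E, F)) x y :
  ip (- T x) y = ip x (- adjop_adj T y).
Proof. by rewrite ipNl ipNr adjopP. Qed.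
Definition opp_op E F (T : 'L(E, F)) : 'L(E, F) := AdjOp (opp_op_subproof T).

Fact scale_op_subproof E F (k : R[i]) (T : 'L(E, F)) x y :
  ip (k *: T x) y = ip x (Num.conj k *: adjop_adj T y).
Proof. by rewrite ipZl ipZr adjopP. Qed.
Definition scale_op E F (k : R[i]) (T : 'L(E, F)) : 'L(E, F) :=
  AdjOp (scale_op_subproof k T).

Section Zmodule.
Variables E F : ipModType A.

Let addA : associative (@add_op E F).
Proof. by move=> ? ? ?; apply: adjop_ext => x /=; rewrite addrA. Qed.
Let addC : commutative (@add_op E F).
Proof. by move=> ? ?; apply: adjop_ext => x /=; rewrite addrC. Qed.
Let add0 : left_id (zero_op E F) (@add_op E F).
Proof. by move=> ?; apply: adjop_ext => x /=; rewrite add0r. Qed.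
Let addN : left_inverse (zero_op E F) (@opp_op E F) (@add_op E F).
Proof. by move=> ?; apply: adjop_ext => x /=; rewrite addNr. Qed.

HB.instance Definition _ := GRing.isZmodule.Build 'L(E, F) addA addC add0 addN.

Let scaleA (k l : R[i]) (T : 'L(E, F)) :
  scale_op k (scale_op l T) = scale_op (k * l) T.
Proof. by apply: adjop_ext => x /=; rewrite scalerA. Qed.
Let scale1 : left_id (1 : R[i]) (@scale_op E F).
Proof. by move=> T; apply: adjop_ext => x /=; rewrite scale1r. Qed.
Let scaleDr : right_distributive (@scale_op E F) +%R.
Proof. by move=> k S T; apply: adjop_ext => x /=; rewrite scalerDr. Qed.
Let scaleDl (T : 'L(E, F)) : {morph (@scale_op E F)^~ T : k l / k + l}.
Proof. by move=> k l; apply: adjop_ext => x /=; rewrite scalerDl. Qed.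

HB.instance Definition _ :=
  GRing.Zmodule_isLmodule.Build R[i] 'L(E, F) scaleA scale1 scaleDr scaleDl.

End Zmodule.

Section Ring.
Variable E : ipModType A.

Let mulA : associative (@comp_op E E E).
Proof. by move=> ? ? ?; apply: adjop_ext. Qed.
Let mul1 : left_id (id_op E) (@comp_op E E E).
Proof. by move=> ?; apply: adjop_ext. Qed.
Let mulI : right_id (id_op E) (@comp_op E E E).
Proof. by move=> ?; apply: adjop_ext. Qed.
Let mulDl : left_distributive (@comp_op E E E) +%R.
Proof. by move=> ? ? ?; apply: adjop_ext. Qed.
Let mulDr : right_distributive (@comp_op E E E) +%R.
Proof. by move=> ? ? ?; apply: adjop_ext => x; exact: adjopD. Qed.

HB.instance Definition _ :=
  GRing.Zmodule_isPzRing.Build 'L(E) mulA mul1 mulI mulDl mulDr.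

End Ring.

End AdjOp.

Notation "T ^†" := (adjoint T) (at level 2, format "T ^†") : ring_scope.
Notation "S \oL T" := (comp_op S T) (at level 40, left associativity) : ring_scope.

(** * Submodules

    A submodule inherits the inner product of the ambient module, so that one
    can speak of adjointable operators between submodules. *)

Record submodule (R : realType) (A : cstarAlgType R) (H : ipModType A) :=
  Submodule {
    sub_set : set H;
    submod0 : sub_set 0;
    submodD : forall x y, sub_set x -> sub_set y -> sub_set (x + y);
    submodZ : forall (k : R[i]) x, sub_set x -> sub_set (k *: x);
    submod_ract : forall x (a : A), sub_set x -> sub_set (ract x a)
  }.

Section Submodule.
Variables (R : realType) (A : cstarAlgType R) (H : ipModType A).

Definition sub_pred (S : submodule H) : {pred H} := [pred x | x \in sub_set S].

Lemma sub_predP (S : submodule H) x : x \in sub_pred S <-> sub_set S x.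
Proof. by rewrite -[x \in sub_pred S]/(x \in sub_set S) in_setE. Qed.

Fact sub_pred_closed (S : submodule H) : submod_closed (sub_pred S).
Proof.
split; first by apply/sub_predP/submod0.
move=> k x y /sub_predP Sx /sub_predP Sy.
by apply/sub_predP/submodD => //; exact: submodZ.
Qed.
HB.instance Definition _ (S : submodule H) :=
  GRing.isSubmodClosed.Build R[i] H (sub_pred S) (sub_pred_closed S).

Record sub_of (S : submodule H) := SubOf {
  sub_val :> H;
  sub_valP : sub_val \in sub_pred S
}.

Variable S : submodule H.

HB.instance Definition _ := [isSub of sub_of S for @sub_val S].
HB.instance Definition _ := [Choice of sub_of S by <:].
HB.instance Definition _ := [SubChoice_isSubLmodule of sub_of S by <:].

Fact sub_ract_subproof (x : sub_of S) (a : A) : ract (val x) a \in sub_pred S.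
Proof.
by apply/sub_predP/submod_ract/sub_predP; exact: valP.
Qed.
Definition sub_ract (x : sub_of S) (a : A) : sub_of S :=
  SubOf (sub_ract_subproof x a).
Definition sub_ip (x y : sub_of S) : A := ip (val x) (val y).

Let sractDl x y a : sub_ract (x + y) a = sub_ract x a + sub_ract y a.
Proof. by apply: val_inj; rewrite /= ractDl. Qed.
Let sractDr x a b : sub_ract x (a + b) = sub_ract x a + sub_ract x b.
Proof. by apply: val_inj; rewrite /= ractDr. Qed.
Let sractM x a b : sub_ract x (cmul a b) = sub_ract (sub_ract x a) b.
Proof. by apply: val_inj; rewrite /= ractM. Qed.
Let sractZl (k : R[i]) x a : sub_ract (k *: x) a = k *: sub_ract x a.
Proof. by apply: val_inj; rewrite /= ractZl. Qed.
Let sractZr (k : R[i]) x a : sub_ract x (k *: a) = k *: sub_ract x a.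
Proof. by apply: val_inj; rewrite /= ractZr. Qed.
Let sipDr x y z : sub_ip x (y + z) = sub_ip x y + sub_ip x z.
Proof. by rewrite /sub_ip /= ipDr. Qed.
Let sipZr (k : R[i]) x y : sub_ip x (k *: y) = k *: sub_ip x y.
Proof. by rewrite /sub_ip /= ipZr. Qed.
Let sip_ract x y a : sub_ip x (sub_ract y a) = cmul (sub_ip x y) a.
Proof. by rewrite /sub_ip /= ip_ract. Qed.
Let sip_star x y : cstar (sub_ip x y) = sub_ip y x.
Proof. by rewrite /sub_ip ip_star. Qed.
Let sip_ge0 x : cpositive (sub_ip x x). Proof. exact: ip_ge0. Qed.
Let sip_eq0 x : sub_ip x x = 0 -> x = 0.
Proof. by move=> /ip_eq0 x0; apply: val_inj. Qed.

HB.instance Definition _ := @isInnerProductModule.Build R A (sub_of S)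
  sub_ract sub_ip sractDl sractDr sractM sractZl sractZr sipDr sipZr
  sip_ract sip_star sip_ge0 sip_eq0.

End Submodule.

Coercion sub_module (R : realType) (A : cstarAlgType R) (H : ipModType A)
  (S : submodule H) : ipModType A := sub_of S.

(** * Idempotents and matched projections *)

Section MatchedProjection.
Variables (R : realType) (A : cstarAlgType R).
Implicit Types E F H : ipModType A.

Section RangeNull.
Variables (E F : ipModType A) (T : 'L(E, F)).

Let ran0 : range T 0. Proof. by exists 0 => //; exact: adjop0. Qed.
Let ranD x y : range T x -> range T y -> range T (x + y).
Proof. by move=> [u _ <-] [v _ <-]; exists (u + v) => //; exact: adjopD. Qed.
Let ranZ (k : R[i]) x : range T x -> range T (k *: x).
Proof. by move=> [u _ <-]; exists (k *: u) => //; exact: adjopZ. Qed.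
Let ranR x (a : A) : range T x -> range T (ract x a).
Proof. by move=> [u _ <-]; exists (ract u a) => //; exact: adjop_ract. Qed.

Definition ran_op : submodule F := Submodule ran0 ranD ranZ ranR.

Let ract0 (a : A) : ract (0 : F) a = 0.
Proof. by rewrite -[X in ract X a](scale0r (0 : F)) ractZl scale0r. Qed.
Let nulD x y : T x = 0 -> T y = 0 -> T (x + y) = 0.
Proof. by move=> x0 y0; rewrite adjopD x0 y0 addr0. Qed.
Let nulZ (k : R[i]) x : T x = 0 -> T (k *: x) = 0.
Proof. by move=> x0; rewrite adjopZ x0 scaler0. Qed.
Let nulR x (a : A) : T x = 0 -> T (ract x a) = 0.
Proof. by move=> x0; rewrite adjop_ract x0 ract0. Qed.

Definition nul_op : submodule E :=
  @Submodule R A E [set x | T x = 0] (adjop0 T) nulD nulZ nulR.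

End RangeNull.

Definition is_idempotent E (Q : 'L(E)) : Prop := Q * Q = Q.

Definition is_projection E (P : 'L(E)) : Prop := is_idempotent P /\ P^† = P.

(** In this section an object characterized by a property is selected with
    [xget]; the default value 0 is only relevant when no such object exists. *)

Definition range_proj E (Q : 'L(E)) : 'L(E) :=
  xget 0 [set P | is_projection P /\ range P = range Q].

(** [f] with its codomain restricted to [S], as an adjointable operator. *)
Definition corestr E H (S : submodule H) (f : E -> H) : 'L(E, S) :=
  xget 0 [set T : 'L(E, S) | forall x, \val (T x) = f x].

Definition op_positive E (T : 'L(E)) : Prop := exists S : 'L(E), T = S^† * S.

Definition op_sqrt E (T : 'L(E)) : 'L(E) :=
  xget 0 [set B | op_positive B /\ B * B = T].

Definition op_inv E (T : 'L(E)) : 'L(E) :=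
  xget 0 [set S | S * T = 1 /\ T * S = 1].

(** [U^* M U] where [M] is the operator matrix [(M11, M12; M21, M22)] on the
    orthogonal sum of E1 and E2 and [U] is the column [(U1; U2)]. *)
Definition block_conj H E1 E2 (U1 : 'L(H, E1)) (U2 : 'L(H, E2))
    (M11 : 'L(E1)) (M12 : 'L(E2, E1)) (M21 : 'L(E1, E2)) (M22 : 'L(E2)) : 'L(H) :=
    U1^† \oL (M11 \oL U1 + M12 \oL U2) + U2^† \oL (M21 \oL U1 + M22 \oL U2).

(** [V] is the restriction of [Q - P] to the null space of [Q^†], with values in
    the range of [Q]; [B] is the square root of [V V^† + 1]. *)
Definition matched_matrix H (Q : 'L(H)) : 'L(H) :=
  let P := range_proj Q in
  let RQ := ran_op Q in
  let NQ := nul_op Q^† in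
  let U1 : 'L(H, RQ) := corestr RQ P in
  let U2 : 'L(H, NQ) := corestr NQ (1 - P : 'L(H)) in
  let V : 'L(NQ, RQ) := corestr RQ (fun k : NQ => (Q - P) (\val k)) in
  let B : 'L(RQ) := op_sqrt (V \oL V^† + 1) in
  let h : R[i] := 2^-1 in
  block_conj U1 U2
    (h *: ((B + 1) * op_inv B))
    (h *: (op_inv B \oL V))
    (h *: (V^† \oL op_inv B))
    (h *: (V^† \oL op_inv (B * (B + 1)) \oL V)).

(** Only meaningful when [Q] is an idempotent. *)
Definition matched_proj H (Q : 'L(H)) : 'L(H) :=
  if `[< is_projection Q >] then Q else matched_matrix Q.

End MatchedProjection.

(* Main.v *)
(** The operators entering [m(Q)], transported to the corner [P L(H) P] of the
    range projection [P] of [Q], are determined by algebraic relations: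
    [P] is the projection with [P Q = Q] and [Q P = P], [B] is the positive root
    of [Q Q^†], and the remaining two are inverses in the corner.  A unital
    *-morphism preserves these relations, so it suffices that they have a
    solution in [L(H)] and at most one in [L(X)].  Existence rests on two facts
    on [L(E)], for a Hilbert module [E]: [1 + S^† S] is invertible, and [S^† S]
    has a positive root that commutes with every operator commuting with
    [S^† S].

    Both facts follow once [a = S^† S] satisfies [|t - a| <= t] for some [t > 0].
    This is Fukamiya's theorem, proved from the C*-identity for operators, which
    needs the Cauchy-Schwarz inequality [|<x, y>| <= |x| |y|].  For the algebra [A]
    as a module over itself the inequality is immediate; the resulting positivity
    in [L(A)] then yields it for every Hilbert A-module. *)

Require Import Defs.
From HB Require Import structures.
From mathcomp Require Import all_boot all_order all_algebra.
From mathcomp Require Import complex.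
From mathcomp Require Import boolp classical_sets filter reals topology normedtype.
From mathcomp Require Import ring lra.
From Stdlib Require Ncring Ncring_tac.

Set Implicit Arguments.
Unset Strict Implicit.
Unset Printing Implicit Defensive.

Import Order.TTheory GRing.Theory Num.Theory.
Import numFieldNormedType.Exports.

Local Open Scope classical_set_scope.
Local Open Scope ring_scope.
Local Open Scope complex_scope.

(** * Real-valued norms and limits with a rate *)

Section RealNorm.
Variables (R : realType) (V : normedModType R[i]).
Implicit Types x y : V.

(** The norm of a module lies in [R[i]]; its real part allows estimates in the ordered field [R]. *)
Definition nrm x : R := complex.Re `|x|.

Lemma nrmE x : `|x| = (nrm x)%:C.
Proof. by have := normr_ge0 x; rewrite /nrm; case: `|x| => a b /=; rewrite lecE /= => /andP[/eqP -> _]. Qed.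

Lemma nrm_ge0 x : 0 <= nrm x.
Proof. by have := normr_ge0 x; rewrite nrmE -[0]/(0%:C) lecR. Qed.

Lemma nrm0 : nrm 0 = 0.
Proof. by rewrite /nrm normr0. Qed.

Lemma nrm_eq0 x : nrm x = 0 -> x = 0.
Proof. by move=> x0; apply/eqP; rewrite -normr_eq0 nrmE x0. Qed.

Lemma nrm_gt0 x : x <> 0 -> 0 < nrm x.
Proof. by move=> x0; rewrite lt_neqAle nrm_ge0 andbT eq_sym; apply/eqP => /nrm_eq0. Qed.

Lemma nrmD x y : nrm (x + y) <= nrm x + nrm y.
Proof. by have := ler_normD x y; rewrite !nrmE -rmorphD lecR. Qed.

Lemma nrmN x : nrm (- x) = nrm x.
Proof. by rewrite /nrm normrN. Qed.

Lemma nrmB x y : nrm (x - y) <= nrm x + nrm y.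
Proof. by rewrite (le_trans (nrmD _ _)) // nrmN. Qed.

Lemma nrmZ (k : R[i]) x : nrm (k *: x) = complex.Re `|k| * nrm x.
Proof.
rewrite /nrm normrZ [`|x|]nrmE normc_def /=.
by rewrite mulr0 subr0.
Qed.

Lemma nrmZr (k : R) x : nrm (k%:C *: x) = `|k| * nrm x.
Proof. by rewrite nrmZ normc_def /= expr0n addr0 sqrtr_sqr. Qed.

End RealNorm.

(** The bound on tails survives in the limit, so later estimates quote a rate and no filter. *)
Lemma cauchy_lim (R : realType) (V : completeNormedModType R[i]) (u : nat -> V)
    (b : nat -> R) :
  (forall m n, (n <= m)%N -> nrm (u m - u n) <= b n) ->
  (forall e, 0 < e -> exists n, b n < e) ->
  exists l, forall n, nrm (l - u n) <= b n.
Proof.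
move=> ub b0.
have uc : cauchy (u @ \oo).
  apply/cauchy_ballP => e e0.
  have [r r0 ->] : exists2 r : R, 0 < r & e = r%:C.
    by case: e e0 => r i; rewrite ltcE /= => /andP[/eqP -> r0]; exists r.
  have [n bn] := b0 _ (divr_gt0 r0 (ltr0n R 2)).
  exists (u @` [set m | (n <= m)%N], u @` [set m | (n <= m)%N]) => /=.
    by split; exists n => // m nm; exists m.
  move=> [x y] /= [[p np <-] [q nq <-]]; rewrite -ball_normE /ball_ /= nrmE ltcR.
  have := nrmB (u p - u n) (u q - u n); rewrite opprB addrA subrK => /le_lt_trans; apply.
  have := ub _ _ np; have := ub _ _ nq; lra.
have /cvg_ex[l ul] : cvg (u @ \oo) by exact: cauchy_cvg.
exists l => n; apply/ler_addgt0Pr => e e0.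
have e0' : 0 < e%:C :> R[i] by rewrite -[0]/(0%:C) ltcR.
move/cvgrPdist_lt: ul => /(_ _ e0')[N _ uN].
have := uN (maxn N n) (leq_maxl _ _); rewrite nrmE ltcR => h.
have h2 := ub _ _ (leq_maxr N n).
have := nrmD (l - u (maxn N n)) (u (maxn N n) - u n); rewrite addrA subrK.
lra.
Qed.

(** * The involutive algebra of adjointable operators *)

Section AdjopAlgebra.
Variables (R : realType) (A : cstarAlgType R).
Implicit Types E F G : ipModType A.

Lemma adjointK E F (T : 'L(E, F)) : T^†^† = T.
Proof. exact: adjop_ext. Qed.

Lemma adjointD E F (S T : 'L(E, F)) : (S + T)^† = S^† + T^†.
Proof. exact: adjop_ext. Qed.

Lemma adjointB E F (S T : 'L(E, F)) : (S - T)^† = S^† - T^†.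
Proof. exact: adjop_ext. Qed.

Lemma adjointZ E F k (T : 'L(E, F)) : (k *: T)^† = Num.conj k *: T^†.
Proof. exact: adjop_ext. Qed.

Lemma adjointZr E F (k : R) (T : 'L(E, F)) : (k%:C *: T)^† = k%:C *: T^†.
Proof. by rewrite adjointZ; congr (_ *: _); exact: conjc_real. Qed.

Lemma adjoint0 E F : (0 : 'L(E, F))^† = 0.
Proof. exact: adjop_ext. Qed.

Lemma adjoint1 E : (1 : 'L(E))^† = 1.
Proof. exact: adjop_ext. Qed.

Lemma adjointM E (S T : 'L(E)) : (S * T)^† = T^† * S^†.
Proof. exact: adjop_ext. Qed.

Lemma adjoint_comp E F G (S : 'L(F, G)) (T : 'L(E, F)) : (S \oL T)^† = T^† \oL S^†.
Proof. exact: adjop_ext. Qed.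

Lemma opZl E k (S T : 'L(E)) : (k *: S) * T = k *: (S * T).
Proof. exact: adjop_ext. Qed.

Lemma opZr E k (S T : 'L(E)) : S * (k *: T) = k *: (S * T).
Proof. by apply: adjop_ext => x /=; exact: adjopZ. Qed.

End AdjopAlgebra.

(** * Norm bounds on operators *)

Definition bnd (R : realType) (A : cstarAlgType R) (E : hilbertModType A)
  (T : 'L(E)) (r : R) := forall x, nrm (T x) <= r * nrm x.

(** A hypothesis of the operator theory below, which is applied first to the algebra acting on
    itself, in order to deduce the inequality, and then to every Hilbert module. *)
Definition cauchy_schwarz (R : realType) (A : cstarAlgType R) (E : hilbertModType A) :=
  forall x y : E, nrm (ip x y) <= nrm x * nrm y.

Section Bounded.
Variables (R : realType) (A : cstarAlgType R) (E : hilbertModType A).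
Implicit Types (S T : 'L(E)) (x y : E) (r s : R).

Lemma nrm_ip x : nrm (ip x x) = nrm x ^+ 2.
Proof.
by have := norm_ip x; rewrite !nrmE -rmorphXn => /(congr1 (@complex.Re R)).
Qed.

Lemma bnd_ge T r s : r <= s -> bnd T r -> bnd T s.
Proof. by move=> rs Tr x; rewrite (le_trans (Tr x)) // ler_wpM2r // nrm_ge0. Qed.

Lemma bndD S T r s : bnd S r -> bnd T s -> bnd (S + T) (r + s).
Proof. by move=> Sr Ts x; rewrite (le_trans (nrmD _ _)) // mulrDl lerD. Qed.

Lemma bndN T r : bnd T r -> bnd (- T) r.
Proof. by move=> Tr x; rewrite nrmN. Qed.

Lemma bndB S T r s : bnd S r -> bnd T s -> bnd (S - T) (r + s).
Proof. by move=> Sr Ts; apply: bndD => //; exact: bndN. Qed.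

Lemma bndM S T r s : 0 <= r -> bnd S r -> bnd T s -> bnd (S * T) (r * s).
Proof.
by move=> r0 Sr Ts x; rewrite (le_trans (Sr _)) // -mulrA ler_wpM2l //; exact: Ts.
Qed.

Lemma bndZ T r (k : R) : 0 <= k -> bnd T r -> bnd (k%:C *: T) (k * r).
Proof.
by move=> k0 Tr x; rewrite nrmZr ger0_norm // -mulrA ler_wpM2l.
Qed.

Lemma bnd1 : bnd (1 : 'L(E)) 1.
Proof. by move=> x; rewrite mul1r. Qed.

Lemma bnd0 : bnd (0 : 'L(E)) 0.
Proof. by move=> x; rewrite nrm0 mul0r. Qed.

Lemma bnd_eq0 T : (forall e, 0 < e -> bnd T e) -> T = 0.
Proof.
move=> T0; apply: adjop_ext => x /=; apply: nrm_eq0; apply/eqP.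
rewrite eq_le nrm_ge0 andbT; apply/ler_addgt0Pr => e e0; rewrite add0r.
have x1 : 0 < nrm x + 1 by rewrite ltr_wpDl // nrm_ge0.
rewrite (le_trans (T0 _ (divr_gt0 e0 x1) x)) // mulrAC ler_pdivrMr //.
by rewrite ler_pM2l // lerDl.
Qed.

Hypothesis CS : cauchy_schwarz E.

(** The C*-identity for operators: Cauchy-Schwarz applies to [|T x|^2 = |<x, T^† T x>|]. *)
Lemma bnd_cstar T r : 0 <= r -> bnd (T^† * T) (r ^+ 2) -> bnd T r.
Proof.
move=> r0 TTr x; rewrite -(@ler_pXn2r _ 2) // ?nnegrE ?mulr_ge0 ?nrm_ge0 //.
have -> : nrm (T x) ^+ 2 = nrm (ip x ((T^† * T) x)) by rewrite -nrm_ip adjopP.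
rewrite (le_trans (CS _ _)) // exprMn mulrC [nrm x ^+ 2]expr2 mulrA.
by rewrite ler_wpM2r ?nrm_ge0 //; exact: TTr.
Qed.

(** In [|T^† x|^2 = |<x, T T^† x>| <= r |x| |T^† x|] a factor [|T^† x|] cancels. *)
Lemma bnd_adjoint T r : 0 <= r -> bnd T r -> bnd (T^†) r.
Proof.
move=> r0 Tr x; have := nrm_ip (T^† x); rewrite adjop_adjP => h.
have : nrm (T^† x) ^+ 2 <= r * nrm x * nrm (T^† x).
  rewrite -h (le_trans (CS _ _)) // mulrC -mulrA [nrm x * _]mulrC mulrA.
  by rewrite ler_wpM2r ?nrm_ge0 //; exact: Tr.
have := nrm_ge0 (T^† x); rewrite le_eqVlt => /predU1P[<- _|n0].
  by rewrite mulr_ge0 ?nrm_ge0.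
by rewrite expr2 ler_pM2r.
Qed.

Lemma bnd_sqr T r : 0 <= r -> T^† = T -> bnd (T * T) (r ^+ 2) -> bnd T r.
Proof. by move=> r0 Ts TT; apply: bnd_cstar => //; rewrite Ts. Qed.

(** Sokal's gliding hump: if [ip (T y) _], [nrm y <= 1], were unbounded, signs
    could be chosen so that it is unbounded at the sum of a series
    [\sum_n +/- h n] of humps of norm [3 ^- n]. *)
Lemma bounded_adjop T : exists r, bnd T r.
Proof.
apply: contrapT => Tunb.
have /choice[y yP] n : exists y, n%:R * 3 ^+ n * nrm y < nrm (T y).
  apply: contrapT => ny; apply: Tunb; exists (n%:R * 3 ^+ n) => x.
  by rewrite leNgt; apply/negP => h; apply: ny; exists x.
have Ty0 n : 0 < nrm (T (y n)).
  by apply: le_lt_trans (yP n); rewrite !mulr_ge0 ?nrm_ge0 // exprn_ge0.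
pose c n : R := (3 ^- n) / nrm (T (y n)).
have c0 n : 0 < c n by rewrite divr_gt0 // invr_gt0 exprn_gt0.
pose h n : E := (c n)%:C *: T (y n).
have hn n : nrm (h n) = 3 ^- n.
  by rewrite nrmZr ger0_norm ?(ltW (c0 n)) // divfK // gt_eqF.
pose f n (x : E) := nrm (ip (T (y n)) x).
have fh n : f n (h n) = nrm (T (y n)) * 3 ^- n.
  rewrite /f ipZr nrmZr nrm_ip ger0_norm ?(ltW (c0 n)) // /c expr2.
  by rewrite mulrA divfK ?gt_eqF // mulrC.
pose fix u n : E := if n is m.+1 then
  (if f m (h m) <= f m (u m + h m) then u m + h m else u m - h m) else 0.
have fu n : f n (h n) <= f n (u n.+1).
  rewrite /=; case: ifPn => //; rewrite -ltNge => lt.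
  (* If the plus sign fails, the minus sign succeeds, since [h n + h n] is the difference of the two
     candidates. *)
  have: f n (h n + h n) <= f n (u n + h n) + f n (u n - h n).
    have -> : h n + h n = (u n + h n) - (u n - h n).
      by rewrite opprB [RHS]addrC addrA subrK.
    by rewrite /f ipDr ipNr; exact: nrmB.
  have -> : f n (h n + h n) = f n (h n) + f n (h n).
    rewrite /f -[X in X + X](scale1r (h n)) -scalerDl ipZr.
    by rewrite (_ : 1 + 1 = (2 : R)%:C) ?nrmZr ?normr_nat ?mulr_natl // rmorph_nat.
  move: lt; lra.
have um n : nrm (u n.+1 - u n) <= 3 ^- n.
  rewrite /=; case: ifP => _; rewrite addrC addrA ?addNr ?add0r ?sub0r ?nrmN hn //.
(* The right-hand side is the geometric sum of [3 ^- k] over [n <= k < m]. *)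
have ub m n : (n <= m)%N -> nrm (u m - u n) <= (3 / 2) * (3 ^- n - 3 ^- m).
  move/subnK <-; elim: (m - n)%N => [|k IH]; first by rewrite add0n !subrr nrm0 mulr0.
  have := nrmD (u (k + n).+1 - u (k + n)%N) (u (k + n)%N - u n).
  rewrite addrA subrK => /le_trans; apply.
  have := um (k + n)%N; rewrite addSn exprS invfM; move: IH.
  set a := nrm _; set b := nrm _; set p := _ ^- (k + n); set q := _ ^- n; lra.
have p3 n : 0 < (3 : R) ^- n by rewrite invr_gt0 exprn_gt0.
have [] := @cauchy_lim R E u (fun n => (3 / 2) * 3 ^- n).
- by move=> m n /ub /le_trans; apply; have := p3 m; lra.
- move=> e e0; have [n ne] : exists n : nat, (3/2) / e < n%:R.
    by exists (Num.truncn ((3/2)/e)).+1; rewrite Num.Theory.truncnS_gt.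
  exists n; rewrite ltr_pdivrMr // in ne.
  rewrite ltr_pdivrMr ?exprn_gt0 //; apply: (lt_trans ne).
  rewrite mulrC ltr_pM2l // -natrX ltr_nat; exact: ltn_expl.
move=> l lu.
(* The humps after the [n]-th add up to norm at most half of [3 ^- n], so [f n l] keeps at least
   half of [f n (h n)], which exceeds [n%:R * nrm (y n)]. *)
have key n : n%:R / 2 * nrm (y n) <= nrm (T^† l) * nrm (y n).
  have: f n l <= nrm (T^† l) * nrm (y n).
    by rewrite /f adjopP mulrC; exact: CS.
  apply: le_trans.
  have : f n (u n.+1) <= f n l + f n (l - u n.+1).
    have -> : f n (u n.+1) = f n (l - (l - u n.+1)) by rewrite opprB addrC subrK.
    rewrite /f (ipDr _ l) ipNr; exact: nrmB.
  have : f n (l - u n.+1) <= nrm (T (y n)) * ((3 / 2) * 3 ^- n.+1).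
    by rewrite (le_trans (CS _ _)) // ler_wpM2l ?nrm_ge0.
  have := fu n; rewrite fh exprS invfM => h1 h2 h3.
  have : n%:R * nrm (y n) <= nrm (T (y n)) * 3 ^- n.
    rewrite ler_pdivlMr ?exprn_gt0 //; rewrite mulrAC; exact/ltW/yP.
  nra.
have yn0 n : (0 < n)%N -> 0 < nrm (y n).
  move=> n0; apply: nrm_gt0 => y0; have := Ty0 n; by rewrite y0 adjop0 nrm0 ltxx.
pose n := (Num.truncn (2 * nrm (T^† l))).+1.
have := key n; rewrite ler_pM2r ?yn0 //.
have : 2 * nrm (T^† l) < n%:R by rewrite Num.Theory.truncnS_gt.
lra.
Qed.

End Bounded.

(** These instances open the non-commutative ring tactic to every [pzRingType], in particular to
    ['L(E)]. *)
#[local] Instance pzRing_Ring_ops (B : pzRingType) :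
  @Ncring.Ring_ops B 0 1 +%R *%R (fun x y => x - y) -%R eq := {}.
#[local] Instance pzRing_Ring (B : pzRingType) : Ncring.Ring (Ro := pzRing_Ring_ops B).
Proof.
split => /=; try by move=> x _ <- // y _ <-.
- exact: RelationClasses.eq_equivalence.
- exact: add0r.
- exact: addrC.
- exact: addrA.
- exact: mul1r.
- exact: mulr1.
- exact: mulrA.
- exact: mulrDl.
- by move=> *; exact: mulrDr.
- by [].
- exact: subrr.
Qed.
Ltac nc := Ncring_tac.non_commutative_ring.

(** * Limits of operator sequences *)

Section OperatorLimit.
Variables (R : realType) (A : cstarAlgType R) (E : hilbertModType A).
Hypothesis CS : cauchy_schwarz E.
Implicit Types (S T : 'L(E)) (x y : E) (r s : R).

Lemma bnd_closed T r : (forall e, 0 < e -> bnd T (r + e)) -> bnd T r.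
Proof.
move=> Tr x; apply/ler_addgt0Pr => e e0.
have x1 : 0 < nrm x + 1 by rewrite ltr_wpDl // nrm_ge0.
rewrite (le_trans (Tr _ (divr_gt0 e0 x1) x)) // mulrDl lerD2l mulrAC ler_pdivrMr //.
by rewrite ler_pM2l // lerDl.
Qed.

(** The adjoints converge at the same rate by [bnd_adjoint]; their pointwise limit supplies the
    adjoint of the pointwise limit of [T]. *)
Lemma op_lim (T : nat -> 'L(E)) (b : nat -> R) :
  (forall n, 0 <= b n) ->
  (forall m n, (n <= m)%N -> bnd (T m - T n) (b n)) ->
  (forall e, 0 < e -> exists n, b n < e) ->
  exists L, forall n, bnd (L - T n) (b n).
Proof.
move=> b_ge0 Tb b0.
have b0' (x : E) e : 0 < e -> exists n, b n * nrm x < e.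
  move=> e0; have x1 : 0 < nrm x + 1 by rewrite ltr_wpDl // nrm_ge0.
  have [n bn] := b0 _ (divr_gt0 e0 x1); exists n.
  rewrite ltr_pdivlMr // in bn; apply: le_lt_trans bn.
  by rewrite ler_wpM2l // lerDl.
have /choice[L LP] x : exists l, forall n, nrm (l - T n x) <= b n * nrm x.
  apply: (@cauchy_lim _ _ (fun n => T n x)); last exact: b0'.
  by move=> m n nm; exact: (Tb m n nm x).
have /choice[L' LP'] x : exists l, forall n, nrm (l - (T n)^† x) <= b n * nrm x.
  apply: (@cauchy_lim _ _ (fun n => (T n)^† x)); last exact: b0'.
  move=> m n nm; have := bnd_adjoint CS (b_ge0 n) (Tb m n nm) x.
  by rewrite adjointB.
have LL x y : ip (L x) y = ip x (L' y).
  apply/eqP; rewrite -subr_eq0; apply/eqP/nrm_eq0/eqP.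
  rewrite eq_le nrm_ge0 andbT; apply/ler_addgt0Pr => e e0; rewrite add0r.
  have xy1 : 0 < 2 * nrm y + 1 by rewrite ltr_wpDl // mulr_ge0 // nrm_ge0.
  have [n xn] := b0' x _ (divr_gt0 e0 xy1).
  have -> : ip (L x) y - ip x (L' y) =
      ip (L x - T n x) y - ip x (L' y - (T n)^† y).
    rewrite ipDl ipNl ipDr ipNr -[ip x ((T n)^† y)]adjopP.
    by rewrite opprB [RHS]addrA subrK.
  rewrite (le_trans (nrmB _ _)) //.
  have := le_trans (CS _ _) (ler_wpM2r (nrm_ge0 y) (LP x n)).
  have := le_trans (CS _ _) (ler_wpM2l (nrm_ge0 x) (LP' y n)).
  rewrite ltr_pdivlMr // in xn.
  have := mulr_ge0 (b_ge0 n) (nrm_ge0 x); move: xn.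
  set p := nrm (ip _ _); set q := nrm (ip _ _); nra.
by exists (AdjOp LL) => n x; exact: LP.
Qed.

(** The increments telescope, so the rate is the distance from [z n] to the supremum of [z]. *)
Lemma op_lim_monotone (T : nat -> 'L(E)) (z : nat -> R) M :
  (forall n, z n <= z n.+1) -> (forall n, z n <= M) ->
  (forall n, bnd (T n.+1 - T n) (z n.+1 - z n)) ->
  exists L (b : nat -> R), [/\ forall n, 0 <= b n, forall n, b n.+1 <= b n,
    forall e, 0 < e -> exists n, b n < e & forall n, bnd (L - T n) (b n)].
Proof.
move=> zS zM Tz.
have zsup : has_sup (range z).
  by split; [exists (z 0%N), 0%N | exists M => _ [n _ <-]].
have zle n : z n <= sup (range z) by apply: sup_upper_bound => //; exists n.
have b0 e : 0 < e -> exists n, sup (range z) - z n < e.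
  move=> e0; have [_ [n _ <-] zn] := sup_adherent e0 zsup.
  by exists n; rewrite ltrBlDl -ltrBlDr.
have [L LT] : exists L, forall n, bnd (L - T n) (sup (range z) - z n).
  apply: op_lim => // [n|m n nm]; first by rewrite subr_ge0.
  apply: (@bnd_ge _ _ _ _ (z m - z n)); first by rewrite lerB.
  move/subnK: nm => <-; elim: (m - n)%N => [|k IH].
    by rewrite add0n !subrr; exact: bnd0.
  rewrite addSn (_ : T _ - _ = (T (k + n).+1 - T (k + n)%N) + (T (k + n)%N - T n)).
    rewrite (_ : z _ - _ = (z (k + n).+1 - z (k + n)%N) + (z (k + n)%N - z n)).
      exact: bndD.
    by rewrite addrA subrK.
  by rewrite addrA subrK.
exists L, (fun n => sup (range z) - z n); split => // n; first by rewrite subr_ge0.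
by rewrite lerB.
Qed.

End OperatorLimit.

(** * A quadratic equation for operators *)

Section Roots.
Variables (R : realType) (A : cstarAlgType R) (E : hilbertModType A).
Hypothesis CS : cauchy_schwarz E.
Implicit Types (S T a b c h k l : 'L(E)) (x y : E) (r s t : R).

Local Notation half := (2^-1 : R)%:C.

Lemma half_double T : half *: T + half *: T = T.
Proof.
rewrite -scalerDl -rmorphD /= (_ : 2^-1 + 2^-1 = 1 :> R) ?scale1r //.
by rewrite [RHS]splitr div1r.
Qed.

(** Solves [(1 - z) ^ 2 = 1 - h]. The iterates are polynomials in [h] with
    nonnegative coefficients, so they are dominated by those for [h = 1]. *)
Lemma quadratic_root h : bnd h 1 -> exists z,
  [/\ bnd z 1, z + z = h + z * z, h^† = h -> z^† = z &
      forall c, c * h = h * c -> c * z = z * c].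
Proof.
move=> h1.
pose fix z n : 'L(E) := if n is m.+1 then half *: (h + z m * z m) else 0.
pose fix q n : R := if n is m.+1 then 2^-1 * (1 + q m * q m) else 0.
have zE n : z n.+1 = half *: (h + z n * z n) by [].
have qE n : q n.+1 = 2^-1 * (1 + q n * q n) by [].
have q01 n : 0 <= q n <= 1.
    elim: n => [|n /andP[IH0 IH1]] /=; first by rewrite lexx ler01.
    apply/andP; split; first by rewrite mulr_ge0 ?invr_ge0 // addr_ge0 // mulr_ge0.
    by have := mulr_ile1 IH0 IH0 IH1 IH1; lra.
have q0 n : 0 <= q n by case/andP: (q01 n).
have q1 n : q n <= 1 by case/andP: (q01 n).
have qS n : q n <= q n.+1.
  elim: n => [|n IH]; first exact: q0.
  by rewrite [leRHS]/= [leLHS]/= ler_wpM2l ?invr_ge0 // lerD2l ler_pM.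
have zq n : bnd (z n) (q n).
  elim: n => [|n IH] /=; first exact: bnd0.
  by apply: bndZ; [lra | apply: bndD => //; exact: bndM].
have zS n : bnd (z n.+1 - z n) (q n.+1 - q n).
  elim: n => [|n IH].
    by rewrite /= !mulr0 !addr0 !subr0; apply: bndZ => //; lra.
  have -> : z n.+2 - z n.+1 =
      half *: (z n.+1 * (z n.+1 - z n) + (z n.+1 - z n) * z n).
    rewrite (zE n.+1) [X in _ - X = _]zE -scalerBr; congr (_ *: _); nc.
  have -> : q n.+2 - q n.+1 = 2^-1 * (q n.+1 * (q n.+1 - q n) + (q n.+1 - q n) * q n).
    by rewrite (qE n.+1) [X in _ - X = _]qE; ring.
  apply: bndZ; first lra.
  by apply: bndD; apply: bndM => //; rewrite subr_ge0.
have [L [b [b_ge0 bS b0 Lb]]] := op_lim_monotone CS qS q1 zS.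
have L1 : bnd L 1.
  apply: bnd_closed => e /b0[n bn].
  rewrite -[L](subrK (z n)); apply: (@bnd_ge _ _ _ _ (b n + q n)).
    by have := q1 n; lra.
  exact: bndD.
have LE : L - half *: (h + L * L) = 0.
  apply: bnd_eq0 => e e0; have [n bn] := b0 _ (divr_gt0 e0 (ltr0n R 2)).
  (* As [z n.+1] is the iteration step at [z n], the defect of [L] is made of the errors
     [L - z n.+1] and [L - z n]. *)
  have -> : L - half *: (h + L * L) =
      (L - z n.+1) - half *: (L * (L - z n) + (L - z n) * z n).
    rewrite zE -addrA -opprD -scalerDr; congr (_ - _ *: _); nc.
  apply: (@bnd_ge _ _ _ _ (b n.+1 + 2^-1 * (1 * b n + b n * q n))).
    have := b_ge0 n; have := q1 n; have := q0 n; have := bS n; nra.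
  apply: bndB => //; apply: bndZ; first lra.
  by apply: bndD; apply: bndM => //; lra.
exists L; split => //.
- by move/eqP: LE; rewrite subr_eq0 => /eqP {1 2}->; exact: half_double.
- move=> hs; have zs n : (z n)^† = z n.
    by elim: n => [|n IH] /=; rewrite ?adjoint0 // adjointZr adjointD adjointM hs IH.
  apply/eqP; rewrite -subr_eq0; apply/eqP/bnd_eq0 => e e0.
  have [n bn] := b0 _ (divr_gt0 e0 (ltr0n R 2)).
  rewrite (_ : _ - _ = (L - z n)^† - (L - z n)).
    apply: (@bnd_ge _ _ _ _ (b n + b n)); first lra.
    by apply: bndB => //; exact: bnd_adjoint.
  by rewrite adjointB zs; nc.
- move=> c ch; have cz n : c * z n = z n * c.
    elim: n => [|n IH] /=; first by rewrite mul0r mulr0.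
    rewrite opZl opZr mulrDl mulrDr ch; congr (_ *: (_ + _)).
    by rewrite mulrA IH -mulrA IH mulrA.
  apply/eqP; rewrite -subr_eq0; apply/eqP/bnd_eq0 => e e0.
  (* The commutator of [c] with [L] equals that with the error [L - z n]; it is small because [c] is
     automatically bounded. *)
  have [r cr] := bounded_adjop CS c.
  have cr' : bnd c `|r| by apply: bnd_ge cr; exact: ler_norm.
  have r1 : 0 < 2 * `|r| + 1 by rewrite ltr_wpDl // mulr_ge0.
  have [n bn] := b0 _ (divr_gt0 e0 r1); rewrite ltr_pdivlMr // in bn.
  rewrite (_ : _ - _ = c * (L - z n) - (L - z n) * c).
    apply: (@bnd_ge _ _ _ _ (`|r| * b n + b n * `|r|)).
      by have := b_ge0 n; lra.
    by apply: bndB; apply: bndM.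
  transitivity (c * L - L * c + (z n * c - c * z n)); last by nc.
  by rewrite cz subrr addr0.
Qed.

End Roots.

(** * Positivity through norm estimates *)

Section Positive.
Variables (R : realType) (A : cstarAlgType R) (E : hilbertModType A).
Hypothesis CS : cauchy_schwarz E.
Implicit Types (S T a b c h k l : 'L(E)) (x y : E) (r s t : R).

Local Notation scal r := (r%:C *: (1 : 'L(E))).

(** Positivity through the norm makes closure under sums immediate; that every
    [S^† * S] is positive in this sense is [pos_gram]. *)
Definition pos a := a^† = a /\ exists2 t : R, 0 < t & bnd (scal t - a) t.

Lemma scalC r T : T * (scal r) = (scal r) * T.
Proof. by rewrite opZl opZr mul1r mulr1. Qed.

Lemma rscalerA r s T : r%:C *: (s%:C *: T) = (r * s)%:C *: T.
Proof. by rewrite scalerA -rmorphM. Qed.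

Lemma rscalerD r s T : (r + s)%:C *: T = r%:C *: T + s%:C *: T.
Proof. by rewrite rmorphD scalerDl. Qed.

Lemma rscale1 T : (1 : R)%:C *: T = T.
Proof. by rewrite rmorph1 scale1r. Qed.

Lemma bnd_scal r : 0 <= r -> bnd (scal r) r.
Proof. by move=> r0; rewrite -[r in bnd _ r]mulr1; apply: bndZ => //; exact: bnd1. Qed.

Lemma bounded_adjop_gt0 T : exists2 r, 0 < r & bnd T r.
Proof.
have [r Tr] := bounded_adjop CS T; exists (`|r| + 1); first by rewrite ltr_wpDl.
by apply: bnd_ge Tr; rewrite (le_trans (ler_norm r)) // lerDl.
Qed.

Lemma posD a b : pos a -> pos b -> pos (a + b).
Proof.
move=> [aa [s s0 sa]] [bb [t t0 tb]]; split; first by rewrite adjointD aa bb.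
exists (s + t); first exact: addr_gt0.
by rewrite rscalerD opprD addrACA; exact: bndD.
Qed.

Lemma posZ r a : 0 < r -> pos a -> pos (r%:C *: a).
Proof.
move=> r0 [aa [t t0 ta]]; split; first by rewrite adjointZr aa.
exists (r * t); first exact: mulr_gt0.
by rewrite -rscalerA -scalerBr; apply: bndZ => //; exact: ltW.
Qed.

Lemma pos_subr r a : 0 < r -> a^† = a -> bnd a r -> pos (scal r - a).
Proof.
move=> r0 aa ar; split; first by rewrite adjointB aa adjointZr adjoint1.
by exists r => //; rewrite opprB addrC subrK.
Qed.

(** For [h = 1 - a / t], [quadratic_root] gives [(1 - z)^2 = a / t]. The root is [1 - z] scaled by
    the square root of [t], and [|z| <= 1] yields its positivity. *)
Lemma pos_sqrt a : pos a -> exists b,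
  [/\ pos b, b * b = a & forall c, c * a = a * c -> c * b = b * c].
Proof.
move=> [aa [t t0 ta]].
have ti0 : 0 <= t^-1 by rewrite invr_ge0 ltW.
pose h := t^-1%:C *: (scal t - a).
have h1 : bnd h 1 by rewrite -(mulVf (lt0r_neq0 t0)); exact: bndZ.
have hE : 1 - h = t^-1%:C *: a.
  by rewrite /h scalerBr rscalerA mulVf ?lt0r_neq0 // rscale1 opprB addrC subrK.
have [z [z1 zz zs zc]] := quadratic_root CS h1.
have {}zs : z^† = z by apply: zs; rewrite adjointZr adjointB aa adjointZr adjoint1.
have q0 : 0 < Num.sqrt t by rewrite sqrtr_gt0.
have qq : Num.sqrt t * Num.sqrt t = t by rewrite -expr2 sqr_sqrtr // ltW.
exists ((Num.sqrt t)%:C *: (1 - z)); split.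
- split; first by rewrite adjointZr adjointB adjoint1 zs.
  exists (Num.sqrt t) => //; rewrite -scalerBr opprB addrC subrK -[X in bnd _ X]mulr1.
  by apply: bndZ => //; exact: ltW.
- rewrite opZl opZr rscalerA qq.
  have -> : (1 - z) * (1 - z) = 1 - (z + z) + z * z by nc.
  have -> : 1 - (z + z) + z * z = 1 - h by rewrite zz; nc.
  by rewrite hE rscalerA mulfV ?lt0r_neq0 // rscale1.
- move=> c ca; rewrite opZl opZr; congr (_ *: _).
  rewrite mulrBr mulrBl mulr1 mul1r zc // /h opZl opZr; congr (_ *: _).
  by rewrite mulrBr mulrBl ca scalC.
Qed.

(** [k + 'i l] and its adjoint are [s] times a unitary. *)
Lemma bnd_sum_sqr k l s : 0 <= s -> k^† = k -> l^† = l -> k * l = l * k ->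
  k * k + l * l = scal (s ^+ 2) -> bnd k s.
Proof.
move=> s0 kk ll kl kls.
pose i : 'L(E) := ('i : R[i]) *: (1 : 'L(E)).
have ic T : T * i = i * T by rewrite opZl opZr mulr1 mul1r.
have ii : i * i = -1 by rewrite opZl opZr mulr1 scalerA -expr2 sqrCi scaleN1r.
pose u := k + i * l.
have us : u^† = k - i * l.
  rewrite adjointD adjointM kk ll adjointZ adjoint1 conjCi scaleNr mulrN.
  by rewrite -/i ic.
have uu : u^† * u = scal (s ^+ 2).
  rewrite us /u -kls.
  transitivity (k * k + i * i * (- (l * l)) + (k * i - i * k) * l
     + i * (k * l - l * k) + i * (i * l - l * i) * l); first by nc.
  by rewrite ii (ic k) (ic l) kl !subrr; nc.
have ub : bnd u s by apply: bnd_cstar => //; rewrite uu; apply: bnd_scal; rewrite exprn_ge0.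
have -> : k = 2^-1%:C *: (u + u^†).
  by rewrite us /u addrACA subrr addr0 scalerDr half_double.
apply: (@bnd_ge _ _ _ _ (2^-1 * (s + s))); first lra.
by apply: bndZ; [lra | apply: bndD => //; exact: bnd_adjoint].
Qed.

(** A self-adjoint root [y] of [r^2 - a^2] commuting with [a] satisfies [|y| <= r] by
    [bnd_sum_sqr]. *)
Lemma bnd_sub_sqr a r : 0 < r -> a^† = a -> bnd a r ->
  bnd (scal (r ^+ 2) - a * a) (r ^+ 2).
Proof.
move=> r0 aa ar; have r20 : 0 < r ^+ 2 by rewrite exprn_gt0.
pose h := (r ^- 2)%:C *: (a * a).
have h1 : bnd h 1.
  rewrite -(mulVf (lt0r_neq0 r20)) [X in _ * X]expr2.
  by apply: bndZ; [rewrite invr_ge0 ltW | apply: bndM => //; exact: ltW].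
have [z [z1 zz zs zc]] := quadratic_root CS h1.
have {}zs : z^† = z by apply: zs; rewrite adjointZr adjointM aa.
have az : a * z = z * a by apply: zc; rewrite opZl opZr mulrA.
pose y := r%:C *: (1 - z).
have yy : y * y = scal (r ^+ 2) - a * a.
  rewrite opZl opZr rscalerA -expr2.
  have -> : (1 - z) * (1 - z) = 1 - (z + z) + z * z by nc.
  have -> : 1 - (z + z) + z * z = 1 - h by rewrite zz; nc.
  by rewrite scalerBr rscalerA mulfV ?lt0r_neq0 // rscale1.
rewrite -yy expr2.
have ys : y^† = y by rewrite adjointZr adjointB adjoint1 zs.
have yr : bnd y r.
  apply: (@bnd_sum_sqr _ a) => //; first exact: ltW.
    by rewrite opZl opZr mulrBl mulrBr mul1r mulr1 az.
  by rewrite yy subrK.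
by apply: bndM => //; exact: ltW.
Qed.

Lemma pos_sqr a : a^† = a -> pos (a * a).
Proof.
move=> aa; split; first by rewrite adjointM aa.
have [r r0 ar] := bounded_adjop_gt0 a.
by exists (r ^+ 2); [rewrite exprn_gt0 | exact: bnd_sub_sqr].
Qed.

(** The definition of [pos] provides a single [t]; writing [a] as the square of its root shows that
    every positive bound of [a] serves. *)
Lemma bnd_sub_pos a r : 0 < r -> pos a -> bnd a r -> bnd (scal r - a) r.
Proof.
move=> r0 pa ar; have [b [[bb _] ba _]] := pos_sqrt pa.
have q0 : 0 < Num.sqrt r by rewrite sqrtr_gt0.
have <- : Num.sqrt r ^+ 2 = r by rewrite sqr_sqrtr // ltW.
rewrite -ba; apply: bnd_sub_sqr => //.
by apply: bnd_sqr => //; [exact: ltW | rewrite ba sqr_sqrtr // ltW].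
Qed.

(** The norm is monotone on positive operators: [r - a = (r - (a + b)) + b] is positive, and the
    commuting roots of [a] and [r - a] fall under [bnd_sum_sqr]. *)
Lemma bnd_le_pos a b r : 0 < r -> pos a -> pos b -> bnd (a + b) r -> bnd a r.
Proof.
move=> r0 pa pb abr; have q0 : 0 < Num.sqrt r by rewrite sqrtr_gt0.
have qq : Num.sqrt r ^+ 2 = r by rewrite sqr_sqrtr // ltW.
have [k [[kk _] ka kc]] := pos_sqrt pa.
have pra : pos (scal r - a).
  have -> : scal r - a = (scal r - (a + b)) + b by nc.
  by apply: posD => //; apply: pos_subr => //; case: (posD pa pb).
have [l [[ll _] lra lc]] := pos_sqrt pra.
have kr : bnd k (Num.sqrt r).
  apply: (@bnd_sum_sqr _ l) => //; first exact: ltW.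
    apply: lc; rewrite mulrBr mulrBl scalC; congr (_ - _).
    by rewrite -ka mulrA.
  by rewrite ka lra addrC subrK qq.
by rewrite -ka -qq expr2; apply: bndM => //; exact: ltW.
Qed.

End Positive.

(** * Positivity of Gram operators, inverses and unique roots *)

Section Gram.
Variables (R : realType) (A : cstarAlgType R) (E : hilbertModType A).
Hypothesis CS : cauchy_schwarz E.
Implicit Types (S T a b c e h k l : 'L(E)) (x y : E) (r s t : R).
Local Notation scal r := (r%:C *: (1 : 'L(E))).
Local Notation half := (2^-1 : R)%:C.

Lemma sqr_eq0 a : a^† = a -> a * a = 0 -> a = 0.
Proof.
move=> aa a0; apply: bnd_eq0 => r r0; apply: bnd_sqr => //; first exact: ltW.
by rewrite a0; apply: bnd_ge (@bnd0 _ _ E); rewrite exprn_ge0 // ltW.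
Qed.

Lemma pos_sum_eq0 a b : pos a -> pos b -> a + b = 0 -> a = 0.
Proof.
move=> pa pb ab; apply: bnd_eq0 => r r0; apply: (@bnd_le_pos _ _ _ CS a b) => //.
by rewrite ab; apply: bnd_ge (@bnd0 _ _ E); exact: ltW.
Qed.

Lemma bnd_half a r : bnd (a + a) r -> bnd a (2^-1 * r).
Proof.
by move=> ar; rewrite -(half_double a) -scalerDr; apply: bndZ => //; lra.
Qed.

(** The fourth root of 1/2: a bound [N^2 / 2] on [g^2] reaches [c] through two square roots. *)
Let theta : R := Num.sqrt (Num.sqrt 2^-1).

(** With [g = e * e] and [N = r ^ 2], the hypotheses give
    [(N - c c^†) c = c (N + g)], whence [|g (N + g)| <= N ^ 2]; as [g <= N], this
    forces [2 g ^ 2 <= N ^ 2], which improves the bound on [c^† c = - g]. *)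
Lemma gram_neg_shrink c e r : 0 < r -> c^† * c = - (e * e) -> e^† = e ->
  pos (c * c^†) -> bnd c r -> bnd c (r * theta).
Proof.
move=> r0 ce ee pF cr; have r0' := ltW r0.
pose N := r * r; have N0 : 0 < N by rewrite mulr_gt0.
have N0' := ltW N0; have NN0 : 0 < N * N by rewrite mulr_gt0.
have cr' : bnd (c^†) r by exact: bnd_adjoint.
pose g := e * e; have gs : g^† = g by rewrite adjointM ee.
have gc : c^† * c = - g by [].
have gN : bnd g N by rewrite -[g]opprK -gc; apply: bndN; exact: bndM.
have FN : bnd (scal N - c * c^†) N by apply: bnd_sub_pos => //; exact: bndM.
have cNg : (scal N - c * c^†) * c = c * (scal N + g).
  rewrite mulrBl -mulrA gc mulrN opprK mulrDr scalC; congr (_ + _).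
have gNg : bnd (g * (scal N + g)) (N * N).
  have -> : g * (scal N + g) = - (c^† * (c * (scal N + g))).
    by rewrite mulrA gc mulNr opprK.
  have -> : N * N = r * (N * r) by rewrite /N; ring.
  by apply: bndN; apply: bndM => //; rewrite -cNg; exact: bndM.
have p1 : pos (scal (N * N) - g * (scal N + g)).
  apply: pos_subr => //.
  by rewrite adjointM adjointD gs adjointZr adjoint1 mulrDl mulrDr scalC.
have [q [[qs _] qg qc]] := pos_sqrt CS (pos_subr N0 gs gN).
have eq : e * q = q * e.
  by apply: qc; rewrite mulrBr mulrBl scalC /g mulrA.
have p2 : pos (g * (scal N - g)).
  have -> : g * (scal N - g) = (e * q) * (e * q).
    by rewrite -qg /g -!mulrA; congr (e * _); rewrite !mulrA eq.
  by apply: pos_sqr => //; rewrite adjointM qs ee.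
have p3 : pos (g * g + g * g) by apply: posD; exact: pos_sqr.
have gg : bnd (g * g + g * g) (N * N).
  apply: (bnd_le_pos CS NN0 p3 (posD p1 p2)).
  have -> : g * g + g * g + (scal (N * N) - g * (scal N + g) + g * (scal N - g))
    = scal (N * N) by nc.
  by apply: bnd_scal; exact: ltW.
have th : theta ^+ 2 = Num.sqrt 2^-1 by rewrite sqr_sqrtr // sqrtr_ge0.
have th4 : theta ^+ 2 * theta ^+ 2 = 2^-1.
  by rewrite th -expr2 sqr_sqrtr // invr_ge0.
apply: bnd_cstar => //; first by rewrite mulr_ge0 // sqrtr_ge0.
rewrite gc; apply: bndN; apply: bnd_sqr => //.
  by rewrite exprn_ge0 // mulr_ge0 // sqrtr_ge0.
have -> : ((r * theta) ^+ 2) ^+ 2 = 2^-1 * (N * N).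
  by rewrite -th4 /N; ring.
exact: bnd_half.
Qed.

Lemma gram_neg_eq0 c e : c^† * c = - (e * e) -> e^† = e ->
  pos (c * c^†) -> c = 0.
Proof.
move=> ce ee pc; have [r r0 cr] := bounded_adjop_gt0 CS c.
have th0 : 0 < theta by rewrite !sqrtr_gt0 invr_gt0.
have crn n : bnd c (r * theta ^+ n).
  elim: n => [|n IH]; first by rewrite mulr1.
  rewrite exprSr mulrA; apply: gram_neg_shrink ce ee pc IH.
  by rewrite mulr_gt0 // exprn_gt0.
have th4 : theta ^+ 4 = 2^-1.
  by rewrite (exprM _ 2 2) sqr_sqrtr ?sqrtr_ge0 // sqr_sqrtr // invr_ge0.
(* Four shrinkings halve the bound, and [r / d < m < 2^m] brings it below [d]. *)
apply: bnd_eq0 => d d0; pose m := (Num.truncn (r / d)).+1.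
have := crn (4 * m)%N; rewrite exprM th4 exprVn; apply: bnd_ge.
have : r / d < m%:R by rewrite Num.Theory.truncnS_gt.
rewrite ltr_pdivrMr // => /ltW rd.
rewrite ler_pdivrMr ?exprn_gt0 // (le_trans rd) // mulrC ler_pM2l //.
by rewrite -natrX ler_nat ltnW // ltn_expl.
Qed.

(** With [w = |a|], [v = w^(1/2)] and [n = w - a], the operator [c = S n] satisfies
    [c^† c = n a n = - (v n) ^ 2], whereas [2 (c c^† + c^† c)] is a sum of squares
    of self-adjoint operators; hence [c = 0], [n = 0] and [a = w]. *)
Lemma pos_gram S : pos (S^† * S).
Proof.
set a := S^† * S; have aa : a^† = a by rewrite adjointM adjointK.
have [w [pw wa wc]] := pos_sqrt CS (pos_sqr CS aa).
have [v [pv vw vc]] := pos_sqrt CS pw.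
have [ws _] := pw; have [vs _] := pv.
have aw : a * w = w * a by apply: wc; rewrite mulrA.
pose n := w - a.
have ns : n^† = n by rewrite adjointB ws aa.
have nw : n * w = w * n by rewrite mulrBl mulrBr aw.
have nv : n * v = v * n by exact: vc.
have an : a * n = - (w * n).
  by rewrite mulrBr mulrBr aw wa opprB.
have nn : n * n = w * n + w * n by rewrite {1}/n mulrBl an opprK.
pose e := v * n.
have es : e^† = e by rewrite adjointM vs ns.
have ee : e * e = n * w * n.
  by rewrite /e -{1}nv -mulrA (mulrA v) vw mulrA.
pose c := S * n.
have cc : c^† * c = - (e * e).
  by rewrite adjointM ns -mulrA (mulrA _ S) -/a an mulrN ee mulrA.
have p : pos (c * c^†).
  pose y : 'L(E) := ('i : R[i]) *: (c - c^†).
  have ys : y^† = y.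
    by rewrite adjointZ adjointB adjointK conjCi scaleNr -scalerN opprB.
  have xs : (c + c^†)^† = c + c^† by rewrite adjointD adjointK addrC.
  have yy : y * y = - ((c - c^†) * (c - c^†)).
    by rewrite opZl opZr scalerA -expr2 sqrCi scaleN1r.
  have -> : c * c^† = half *: ((c + c^†) * (c + c^†) + y * y + (e * e + e * e)).
    rewrite -[LHS]half_double -scalerDr; congr (_ *: _).
    transitivity (c * c^† + c * c^† + (c^† * c + e * e) + (c^† * c + e * e)).
      by rewrite cc addNr !addr0.
    by rewrite yy; nc.
  apply: posZ; first by rewrite invr_gt0.
  by do !apply: posD; exact: pos_sqr.
have c0 : c = 0 by exact: gram_neg_eq0 cc es p.
have n0 : n = 0.
  apply: sqr_eq0 => //; apply: sqr_eq0; first by rewrite adjointM ns.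
  have e0 : e * e = 0 by rewrite -[_ * _]opprK -cc c0 mulr0 oppr0.
  (* By [nn] the fourth power of [n] is twice [e * e * n]. *)
  transitivity (n * (n * n) * n); first by rewrite !mulrA.
  by rewrite nn (mulrDr n) mulrA -ee e0 addr0 mul0r.
by move/eqP: n0; rewrite subr_eq0 => /eqP <-.
Qed.

(** A Neumann series: [1 + a = (t + 1) (1 - h)] with [|h| <= t / (t + 1) < 1]. The limit is a right
    inverse; by self-adjointness of [a] its adjoint is a left inverse, so the two agree. *)
Lemma pos_inverse a : pos a -> exists K, K * (1 + a) = 1 /\ (1 + a) * K = 1.
Proof.
move=> [aa [t t0 ta]].
have t10 : 0 < t + 1 by rewrite addr_gt0.
have t1i : 0 <= (t + 1)^-1 by rewrite invr_ge0 ltW.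
pose h := (t + 1)^-1%:C *: (scal t - a); pose rho := (t + 1)^-1 * t.
have hr : bnd h rho by exact: bndZ.
have rho0 : 0 <= rho by rewrite mulr_ge0 // ltW.
have hE : (t + 1)%:C *: (1 - h) = 1 + a.
  rewrite scalerBr rscalerA mulfV ?lt0r_neq0 // rscale1 rscalerD rscale1; nc.
pose fix y n : 'L(E) := if n is m.+1 then 1 + h * y m else 0.
pose fix z n : R := if n is m.+1 then 1 + rho * z m else 0.
have zS n : z n <= z n.+1.
  elim: n => [|n IH]; first by rewrite [leRHS]/= mulr0 addr0.
  by rewrite [leRHS]/= [leLHS]/= lerD2l ler_wpM2l.
have zM n : z n <= t + 1.
  elim: n => [|n IH]; first exact: ltW.
  have -> : t + 1 = 1 + rho * (t + 1) by rewrite mulrAC mulVf ?lt0r_neq0 // mul1r addrC.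
  by rewrite [leLHS]/= lerD2l ler_wpM2l.
have yS n : bnd (y n.+1 - y n) (z n.+1 - z n).
  elim: n => [|n IH]; first by rewrite /= !mulr0 !subr0 !addr0; exact: bnd1.
  rewrite (_ : _ - _ = h * (y n.+1 - y n)); last by rewrite /=; nc.
  rewrite (_ : z _ - _ = rho * (z n.+1 - z n)); last by rewrite /=; ring.
  exact: bndM.
have [L [b [b_ge0 bS b0 Lb]]] := op_lim_monotone CS zS zM yS.
have hL : (1 - h) * L = 1.
  apply/eqP; rewrite -subr_eq0; apply/eqP/bnd_eq0 => e e0.
  have r1 : 0 < 1 + rho by rewrite ltr_wpDr.
  have [n bn] := b0 _ (divr_gt0 e0 r1); rewrite ltr_pdivlMr // in bn.
  rewrite (_ : _ - 1 = (L - y n.+1) - h * (L - y n)); last by rewrite /=; nc.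
  apply: (@bnd_ge _ _ _ _ (b n.+1 + rho * b n)); first by have := bS n; lra.
  by apply: bndB => //; exact: bndM.
pose K := (t + 1)^-1%:C *: L.
have KR : (1 + a) * K = 1.
  by rewrite -hE opZl opZr rscalerA mulfV ?lt0r_neq0 // rscale1.
have KL : K^† * (1 + a) = 1.
  by rewrite -[LHS]adjointK adjointM adjointD adjoint1 aa adjointK KR adjoint1.
have KK : K = K^† by rewrite -[LHS]mul1r -[in LHS]KL -mulrA KR mulr1.
by exists K; split => //; rewrite [X in X * _]KK.
Qed.

(** For [x = a - b] the positive operators [x a x] and [x b x] have sum 0, so both vanish; their
    difference is [x^3], whence [x = 0]. *)
Lemma pos_root_unique S a b : a = S^† * S -> pos b -> a * a = b * b ->
  (forall c, c * (a * a) = (a * a) * c -> c * b = b * c) -> a = b.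
Proof.
move=> aS pb ab bc; have [k [[kk _] kb _]] := pos_sqrt CS pb.
have [bb _] := pb; have aa : a^† = a by rewrite aS adjointM adjointK.
have abC : a * b = b * a by apply: bc; rewrite mulrA.
pose x := a - b; have xs : x^† = x by rewrite adjointB aa bb.
have p1 : pos (x * a * x).
  have -> : x * a * x = (S * x)^† * (S * x) by rewrite adjointM xs aS !mulrA.
  exact: pos_gram.
have p2 : pos (x * b * x).
  have -> : x * b * x = (k * x)^† * (k * x) by rewrite adjointM xs kk -kb !mulrA.
  exact: pos_gram.
have x0 : x * a * x + x * b * x = 0.
  transitivity ((a * a - b * b + (a * b - b * a)) * x); first by rewrite /x; nc.
  by rewrite ab abC !subrr addr0 mul0r.
have xa := pos_sum_eq0 p1 p2 x0.
have xb : x * b * x = 0 by move: x0; rewrite xa add0r.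
have xxx : x * x * x = 0.
  transitivity (x * a * x - x * b * x); first by rewrite /x; nc.
  by rewrite xa xb subrr.
have : x = 0.
  apply: sqr_eq0 => //; apply: sqr_eq0; first by rewrite adjointM xs.
  by rewrite mulrA xxx mul0r.
by move/eqP; rewrite subr_eq0 => /eqP.
Qed.

(** Both are compared with the root from [pos_sqrt], which has the commutation property that
    [pos_root_unique] asks for. *)
Lemma op_positive_root_unique a b :
  op_positive a -> op_positive b -> a * a = b * b -> a = b.
Proof.
move=> [S aS] [T bT] ab.
have aa : a^† = a by rewrite aS adjointM adjointK.
have [d [pd da dc]] := pos_sqrt CS (pos_sqr CS aa).
rewrite (pos_root_unique aS pd); [|by rewrite da|exact: dc].
by rewrite (pos_root_unique bT pd) // -?ab //; exact: dc.
Qed.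

End Gram.

(** * The algebra as a Hilbert module over itself *)

Definition self_module (R : realType) (A : cstarAlgType R) : Type := A.

Section SelfModule.
Variables (R : realType) (A : cstarAlgType R).
Local Notation M := (self_module A).

HB.instance Definition _ := CompleteNormedModule.on M.

Let sip (x y : M) : A := cmul (cstar x) y.
Let sipDr (x y z : M) : sip x (y + z) = sip x y + sip x z. Proof. exact: cmulDr. Qed.
Let sipZr (k : R[i]) (x y : M) : sip x (k *: y) = k *: sip x y.
Proof. by rewrite /sip cscaleAr. Qed.
Let sip_ract (x y : M) (a : A) : sip x (cmul (y : A) a) = cmul (sip x y) a.
Proof. exact: cmulA. Qed.
Let sip_star (x y : M) : cstar (sip x y) = sip y x.
Proof. by rewrite /sip cstarM cstarK. Qed.
Let sip_ge0 (x : M) : cpositive (sip x x). Proof. by exists x. Qed.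
Let sip_eq0 (x : M) : sip x x = 0 -> x = 0.
Proof.
move=> x0; apply/eqP; rewrite -normr_eq0 -sqrf_eq0.
by have := cnorm_star (x : A); rewrite -/(sip x x) x0 normr0 => <-.
Qed.
Let sract (x : M) (a : A) : M := cmul (x : A) a.
Let sractZl (k : R[i]) (x : M) (a : A) : sract (k *: x) a = k *: sract x a.
Proof. by rewrite /sract cscaleAl. Qed.
Let sractZr (k : R[i]) (x : M) (a : A) : sract x (k *: a) = k *: sract x a.
Proof. by rewrite /sract cscaleAr. Qed.

HB.instance Definition _ := @isInnerProductModule.Build R A M
  sract sip (@cmulDl _ A) (@cmulDr _ A) (@cmulA _ A) sractZl sractZr sipDr sipZr
  sip_ract sip_star sip_ge0 sip_eq0.

HB.instance Definition _ := @isHilbertModule.Build R A M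
  (fun x => esym (cnorm_star (x : A))).

End SelfModule.

(** * The Cauchy-Schwarz inequality *)

Section CauchySchwarz.
Variables (R : realType) (A : cstarAlgType R).
Local Notation M := (self_module A).
Implicit Types a b : A.

Lemma nrm_cmul a b : nrm (cmul a b) <= nrm a * nrm b.
Proof. by have := cnormM a b; rewrite !nrmE -rmorphM lecR. Qed.

Lemma nrm_cstar a : nrm (cstar a) = nrm a.
Proof.
suff le b : nrm b <= nrm (cstar b) by apply/eqP; rewrite eq_le -{2}(cstarK a) !le.
have h : nrm b ^+ 2 = nrm (cmul (cstar b) b).
  by have := cnorm_star b; rewrite !nrmE -rmorphXn => /(congr1 (@complex.Re R)).
have := nrm_cmul (cstar b) b; rewrite -h.
have := nrm_ge0 b; rewrite le_eqVlt => /predU1P[<- _|b0]; first exact: nrm_ge0.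
by rewrite expr2 ler_pM2r.
Qed.

Lemma self_module_cauchy_schwarz : cauchy_schwarz M.
Proof. by move=> x y; have := nrm_cmul (cstar (x : A)) y; rewrite nrm_cstar. Qed.

Fact lmul_subproof a (x y : M) :
  ip (cmul a (x : A) : M) y = ip x (cmul (cstar a) (y : A) : M).
Proof. by rewrite -[LHS]/(cmul (cstar (cmul a (x : A))) (y : A)) cstarM -cmulA. Qed.
(** The left regular representation moves [A], which may have no unit, into a unital ring, where
    [1 - b^* b] makes sense. *)
Definition lmul a : 'L(M) := AdjOp (lmul_subproof a).

Lemma lmulM a b : lmul (cmul a b) = lmul a * lmul b.
Proof. by apply: adjop_ext => x; exact: esym (cmulA _ _ _). Qed.

Lemma lmulD a b : lmul (a + b) = lmul a + lmul b.
Proof. by apply: adjop_ext => x; exact: cmulDl. Qed.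

Lemma lmul_star a : lmul (cstar a) = (lmul a)^†.
Proof. exact: adjop_ext. Qed.

Lemma bnd_lmul a : bnd (lmul a) (nrm a).
Proof. by move=> x; exact: nrm_cmul. Qed.

(** Evaluation at [cstar a] suffices, by the C*-identity. *)
Lemma nrm_le_lmul a r : 0 <= r -> bnd (lmul a) r -> nrm a <= r.
Proof.
move=> r0 ar; have := ar (cstar a : M); rewrite -[nrm (lmul a _)]/(nrm (cmul a (cstar a))).
have h : nrm a ^+ 2 = nrm (cmul a (cstar a)).
  have := cnorm_star (cstar a); rewrite !nrmE -rmorphXn => /(congr1 (@complex.Re R)) /=.
  by rewrite cstarK nrm_cstar => ->.
rewrite -h -[nrm (cstar a : M)]/(nrm (cstar a)) nrm_cstar.
have := nrm_ge0 a; rewrite le_eqVlt => /predU1P[<- //|a0]; by rewrite expr2 ler_pM2r.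
Qed.

(** For [|x| = 1], [a = <x, y>], [<x, x> = b^* b] and [<z, z> = d^* d] with
    [z = y - x a], expanding gives [<y, y> = d^* d + a^* a + a^* (1 - b^* b) a],
    a sum of positive terms; so [|a^* a| <= |<y, y>|]. *)
Lemma hilbert_cauchy_schwarz (E : hilbertModType A) : cauchy_schwarz E.
Proof.
suff unit (x y : E) : nrm x = 1 -> nrm (ip x y) <= nrm y.
  move=> x y; have [->|/eqP/nrm_gt0 x0] := eqVneq x 0.
    by rewrite ip0l !nrm0 mul0r.
  pose x' : E := (nrm x)^-1%:C *: x.
  have x'1 : nrm x' = 1.
    by rewrite nrmZr ger0_norm ?invr_ge0 ?(ltW x0) // mulVf ?gt_eqF.
  have -> : nrm (ip x y) = nrm x * nrm (ip x' y).
    rewrite ipZl nrmZ norm_conjC normc_def /= expr0n addr0 sqrtr_sqr.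
    by rewrite ger0_norm ?invr_ge0 ?(ltW x0) // mulrA mulfV ?gt_eqF // mul1r.
  by rewrite ler_wpM2l ?(ltW x0) //; exact: unit.
move=> x1; have [->|/eqP/nrm_gt0 y0] := eqVneq y 0; first by rewrite ip0r !nrm0.
have CS := self_module_cauchy_schwarz.
pose a := ip x y; have [b bE] := ip_ge0 x.
pose z := y - ract x a; have [d dE] := ip_ge0 z.
have yE : ip y y + cmul (cmul (cstar a) (cmul (cstar b) b)) a
    = cmul (cstar d) d + cmul (cstar a) a + cmul (cstar a) a.
  rewrite -dE /z ipDr ipNr !ipDl !ipNl !ip_ract !ip_ractl -bE -/a.
  rewrite -(ip_star x y) -/a opprB.
  set p := cmul (cstar a) a; set q := cmul (cmul _ _) a.
  by rewrite !addrA subrK; rewrite addrAC subrK addrC.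
pose La := lmul a; pose Lb := lmul b; pose D := lmul d.
have LE : lmul (ip y y) = La^† * La + (D^† * D + La^† * (1 - Lb^† * Lb) * La).
  have := congr1 lmul yE; rewrite !lmulD !lmulM !lmul_star -/La -/Lb -/D => e.
  transitivity (D^† * D + La^† * La + La^† * La - La^† * (Lb^† * Lb) * La); last by nc.
  by rewrite -e addrK.
have b1 : nrm (cmul (cstar b) b) = 1 by rewrite -bE nrm_ip x1 expr1n.
have pb : pos (1 - Lb^† * Lb).
  rewrite -(rscale1 1); apply: pos_subr => //.
    by rewrite adjointM adjointK.
  by rewrite -lmul_star -lmulM -b1; exact: bnd_lmul.
have [q [[qs _] qb _]] := pos_sqrt CS pb.
have pab : pos (La^† * (1 - Lb^† * Lb) * La).
  have -> : La^† * (1 - Lb^† * Lb) * La = (q * La)^† * (q * La).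
    by rewrite adjointM qs -qb !mulrA.
  exact: pos_gram.
apply: nrm_le_lmul; first exact: ltW.
apply: (bnd_cstar CS); first exact: ltW.
apply: (bnd_le_pos CS _ (pos_gram CS La) (posD (pos_gram CS D) pab)).
  by rewrite exprn_gt0.
by rewrite -LE -nrm_ip; exact: bnd_lmul.
Qed.

End CauchySchwarz.

(** * Composition, and objects selected by [xget] *)

Section CompOp.
Variables (R : realType) (A : cstarAlgType R).
Implicit Types E F G : ipModType A.

Lemma comp_opA E F G (H : ipModType A) (S : 'L(G, H)) (T : 'L(F, G)) (U : 'L(E, F)) :
  S \oL (T \oL U) = S \oL T \oL U.
Proof. exact: adjop_ext. Qed.

Lemma comp_opDr E F G (S : 'L(F, G)) (T U : 'L(E, F)) :
  S \oL (T + U) = S \oL T + S \oL U.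
Proof. by apply: adjop_ext => x /=; exact: adjopD. Qed.

Lemma comp_opDl E F G (S T : 'L(F, G)) (U : 'L(E, F)) :
  (S + T) \oL U = S \oL U + T \oL U.
Proof. exact: adjop_ext. Qed.

Lemma comp_opZr E F G k (S : 'L(F, G)) (T : 'L(E, F)) :
  S \oL (k *: T) = k *: (S \oL T).
Proof. by apply: adjop_ext => x /=; exact: adjopZ. Qed.

Lemma comp_opZl E F G k (S : 'L(F, G)) (T : 'L(E, F)) :
  (k *: S) \oL T = k *: (S \oL T).
Proof. exact: adjop_ext. Qed.

(** The restriction of [T^†] to [S] is an adjoint of the corestricted map, so the choice in
    [corestr] has a witness. *)
Lemma corestrE E F (S : submodule F) (f : E -> F) (T : 'L(E, F)) :
  f =1 T -> (forall x, sub_set S (T x)) ->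
  forall x, \val (corestr S f x) = f x.
Proof.
move=> fT TS.
have TS' x : T x \in sub_pred S by apply/sub_predP; exact: TS.
have TP x (y : S) : ip (SubOf (TS' x) : S) y = ip x (T^† (\val y)).
  by rewrite -[LHS]/(ip (T x) (\val y)) adjopP.
suff : [set U : 'L(E, S) | forall x, \val (U x) = f x] (corestr S f) by [].
by apply: xgetPex; exists (AdjOp TP) => x /=; rewrite fT.
Qed.

Lemma op_invP E (T S : 'L(E)) : S * T = 1 -> T * S = 1 ->
  op_inv T * T = 1 /\ T * op_inv T = 1.
Proof.
move=> ST TS.
suff : [set S : 'L(E) | S * T = 1 /\ T * S = 1] (op_inv T) by [].
by apply: xgetPex; exists S.
Qed.

Lemma op_sqrtP E (T S : 'L(E)) : op_positive S -> S * S = T ->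
  op_positive (op_sqrt T) /\ op_sqrt T * op_sqrt T = T.
Proof.
move=> Sp ST.
suff : [set B | op_positive B /\ B * B = T] (op_sqrt T) by [].
by apply: xgetPex; exists S.
Qed.

End CompOp.

(** * Algebraic description of the matched projection *)

Section MatchedData.
Variables (R : realType) (A : cstarAlgType R) (E : ipModType A).
Implicit Types Q P B Y G : 'L(E).

(** [B], [Y], [G] are the operators B, B^-1, [B (B + I_1)]^-1 of the paper,
    transported from the range of [Q] to the corner [P L(E) P]; [matched_value] is
    [U^* M U] multiplied out. *)
Record matched_data Q P B Y G : Prop := MatchedData {
  md_idem : P * P = P;
  md_sa : P^† = P;
  md_PQ : P * Q = Q;
  md_QP : Q * P = P;
  md_pos : op_positive B;
  md_PB : P * B = B;
  md_BB : B * B = Q * Q^†;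
  md_PY : P * Y = Y;
  md_YP : Y * P = Y;
  md_YB : Y * B = P;
  md_BY : B * Y = P;
  md_PG : P * G = G;
  md_GP : G * P = G;
  md_GB : G * (B * (B + P)) = P;
  md_BG : B * (B + P) * G = P
}.

Definition matched_value Q P Y G : 'L(E) :=
  (2^-1 : R[i]) *: (P + Y + Y * (Q - P) + (Q - P)^† * Y + (Q - P)^† * G * (Q - P)).

(** Here [B * (B + P)] is twice [Q], with inverse half of [Q] in the corner, and [Q - P = 0]; so the
    projection case of [matched_proj] also has the form [matched_value]. *)
Lemma matched_data_projection Q : is_projection Q ->
  matched_data Q Q Q Q ((2^-1 : R[i]) *: Q) /\
  matched_value Q Q Q ((2^-1 : R[i]) *: Q) = Q.
Proof.
move=> [QQ Qs]; have half_dbl (T : 'L(E)) : (2^-1 : R[i]) *: (T + T) = T.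
  rewrite scalerDr -scalerDl (_ : 2^-1 + 2^-1 = 1) ?scale1r //.
  by rewrite [RHS]splitr div1r.
split; last by rewrite /matched_value subrr mulr0 adjoint0 !mul0r !addr0.
split; rewrite ?opZl ?opZr ?mulrDr ?QQ ?Qs //; first by exists Q; rewrite Qs.
by rewrite mulrDl QQ.
Qed.

End MatchedData.

Section Uniqueness.
Variables (R : realType) (A : cstarAlgType R) (E : hilbertModType A).
Implicit Types Q P B Y G : 'L(E).

Lemma matched_value_unique Q P B Y G P' B' Y' G' :
  matched_data Q P B Y G -> matched_data Q P' B' Y' G' ->
  matched_value Q P Y G = matched_value Q P' Y' G'.
Proof.
move=> d d'.
have PP : P = P'.
  (* The adjoint of [P' P = P] reads [P P' = P], which against [P P' = P'] gives equality. *)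
  have e1 : P * P' = P' by rewrite -(md_QP d') mulrA (md_PQ d).
  have e2 : P' * P = P by rewrite -(md_QP d) mulrA (md_PQ d').
  by rewrite -[LHS]e2 -[in LHS](md_sa d) -[in LHS](md_sa d') -adjointM e1 (md_sa d').
subst P'.
have BB : B = B'.
  apply: (op_positive_root_unique (@hilbert_cauchy_schwarz _ _ E) (md_pos d) (md_pos d')).
  by rewrite (md_BB d) (md_BB d').
subst B'.
have YY : Y = Y' by rewrite -(md_YP d) -(md_BY d') mulrA (md_YB d) (md_PY d').
have GG : G = G' by rewrite -(md_GP d) -(md_BG d') mulrA (md_GB d) (md_PG d').
by rewrite YY GG.
Qed.

End Uniqueness.

(** * Operators on a submodule as a corner *)

Section Corner.
Variables (R : realType) (A : cstarAlgType R) (E : ipModType A).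
Variables (S : submodule E) (P : 'L(E)) (U : 'L(E, S)).
Hypothesis UU1 : U \oL U^† = 1.
Hypothesis UUP : U^† \oL U = P.
Implicit Types (T : 'L(S)) (K : 'L(E)).

(** An isomorphism of involutive algebras from ['L(S)] onto the corner of [P], with inverse
    [compress]. *)
Definition inflate T : 'L(E) := U^† \oL T \oL U.
Definition compress K : 'L(S) := U \oL K \oL U^†.

Lemma inflateM T T' : inflate (T * T') = inflate T * inflate T'.
Proof.
transitivity (U^† \oL T \oL (U \oL U^†) \oL T' \oL U); last exact: adjop_ext.
by rewrite UU1; exact: adjop_ext.
Qed.

Lemma inflateD T T' : inflate (T + T') = inflate T + inflate T'.
Proof. by rewrite /inflate comp_opDr comp_opDl. Qed.

Lemma inflate1 : inflate 1 = P.
Proof. by rewrite -UUP; exact: adjop_ext. Qed.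

Lemma inflate_adjoint T : inflate (T^†) = (inflate T)^†.
Proof. exact: adjop_ext. Qed.

Lemma compressK T : compress (inflate T) = T.
Proof.
transitivity ((U \oL U^†) \oL T \oL (U \oL U^†)); first exact: adjop_ext.
by rewrite UU1; exact: adjop_ext.
Qed.

Lemma inflate_inj : injective inflate.
Proof. exact: can_inj compressK. Qed.

Lemma inflate_compress K : inflate (compress K) = P * K * P.
Proof. by rewrite -UUP; exact: adjop_ext. Qed.

Lemma inflate_positive T : op_positive T -> op_positive (inflate T).
Proof. by move=> [V ->]; exists (inflate V); rewrite inflateM inflate_adjoint. Qed.

Lemma mul_inflate T : P * inflate T = inflate T.
Proof. by rewrite -inflate1 -inflateM mul1r. Qed.

Lemma inflate_mul T : inflate T * P = inflate T.
Proof. by rewrite -inflate1 -inflateM mulr1. Qed.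

End Corner.

(** * The range projection of an idempotent *)

Section RangeProjection.
Variables (R : realType) (A : cstarAlgType R) (E : hilbertModType A).
Variables (Q : 'L(E)).
Hypothesis QQ : is_idempotent Q.

(** Kaplansky's formula [P = Q (Q + Q^† - 1)^-1]; the inverse exists because
    [(Q + Q^† - 1)^2 = 1 + (Q - Q^†)^† (Q - Q^†)]. *)
Lemma range_proj_exists : exists P,
  [/\ is_projection P, P * Q = Q & Q * P = P].
Proof.
have qq : Q * Q = Q by [].
have qs : Q^† * Q^† = Q^† by rewrite -adjointM qq.
pose J := Q + Q^† - 1.
have [K [KJJ JJK]] := pos_inverse (@hilbert_cauchy_schwarz _ _ E)
  (pos_gram (@hilbert_cauchy_schwarz _ _ E) (Q - Q^†)).
have JJ : J * J = 1 + (Q - Q^†)^† * (Q - Q^†).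
  rewrite adjointB adjointK /J.
  transitivity (Q * Q + Q^† * Q^† + Q * Q^† + Q^† * Q + 1
     - Q - Q - Q^† - Q^†); first by nc.
  transitivity (1 + (Q^† * Q + Q * Q^† - Q * Q - Q^† * Q^†)); last by nc.
  by rewrite qq qs; nc.
rewrite -JJ in KJJ JJK.
have JsJ : J^† = J by rewrite /J adjointB adjointD adjointK adjoint1; congr (_ - _); exact: addrC.
have [L [LJ JL]] : exists L, L * J = 1 /\ J * L = 1.
  have KJ : K * J = J * K.
    by rewrite -[RHS]mul1r -KJJ -!mulrA [J * (J * K)]mulrA JJK mulr1.
  by exists (K * J); rewrite -mulrA KJJ KJ mulrA JJK.
have Ls : L^† = L.
  have : L^† * J = 1 by rewrite -{1}JsJ -adjointM JL adjoint1.
  by move=> e; rewrite -[LHS]mulr1 -JL mulrA e mul1r.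
(* [J] intertwines [Q] and [Q^†], hence so does its inverse [L]; this makes [Q * L] self-adjoint. *)
have QJ : Q * J = Q * Q^† by rewrite /J !mulrDr qq mulrN mulr1 addrAC subrr add0r.
have JQ : J * Q = Q^† * Q by rewrite /J !mulrDl qq mulNr mul1r addrAC subrr add0r.
have JQs : J * Q^† = Q * Q^† by rewrite /J !mulrDl qs mulNr mul1r addrK.
have QsJ : Q^† * J = Q^† * Q by rewrite /J !mulrDr qs mulrN mulr1 addrK.
have LQ : L * Q = Q^† * L.
  by rewrite -[LHS]mulr1 -JL -!mulrA (mulrA Q J) QJ -JQs !mulrA LJ mul1r.
have QL : Q * L = L * Q^†.
  by rewrite -[LHS]mul1r -LJ -!mulrA (mulrA J Q) JQ -QsJ -mulrA JL mulr1.
exists (Q * L); split.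
- split; last by rewrite adjointM Ls -QL.
  by rewrite /is_idempotent -mulrA (mulrA L) LQ !mulrA -QJ -(mulrA Q J) JL mulr1.
- by rewrite -mulrA LQ mulrA -QJ -mulrA JL mulr1.
- by rewrite mulrA qq.
Qed.

(** Idempotents fix their range pointwise, so equality of ranges amounts to [P Q = Q] and
    [Q P = P]. *)
Lemma range_projP : let P := range_proj Q in
  [/\ is_projection P, P * Q = Q & Q * P = P].
Proof.
move=> P.
have [[PP Ps] rP] : is_projection P /\ range P = range Q.
  suff : [set P | is_projection P /\ range P = range Q] (range_proj Q) by [].
  apply: xgetPex; have [P0 [P0p PQ QP]] := range_proj_exists.
  exists P0; split => //; apply/seteqP; split => _ [x _ <-].
    by exists (P0 x) => //; rewrite -{2}QP.
  by exists (Q x) => //; rewrite -{2}PQ.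
split => //; apply: adjop_ext => x.
  have : range P (Q x) by rewrite rP; exists x.
  by case=> u _ e; rewrite -[LHS]/(P (Q x)) -e; exact: (congr1 (fun T : 'L(E) => T u) PP).
have : range Q (P x) by rewrite -rP; exists x.
by case=> u _ e; rewrite -[LHS]/(Q (P x)) -e; exact: (congr1 (fun T : 'L(E) => T u) QQ).
Qed.

End RangeProjection.

(** * Existence of the matched data *)

Lemma inverse_of_square (B : pzRingType) (b k : B) :
  k * (b * b) = 1 -> b * b * k = 1 -> k * b * b = 1 /\ b * (k * b) = 1.
Proof.
move=> kb bk; split; first by rewrite -mulrA.
suff -> : k * b = b * k by rewrite mulrA.
by rewrite -[LHS]mulr1 -bk -!mulrA (mulrA b b (b * k)) (mulrA k) kb mul1r.
Qed.

Lemma commute_inverse (B : pzRingType) (p m k : B) :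
  k * m = 1 -> m * k = 1 -> p * m = m * p -> p * k = k * p.
Proof.
by move=> km mk pm; rewrite -[LHS]mul1r -km -!mulrA (mulrA m p) -pm -!mulrA mk mulr1.
Qed.

Section Existence.
Variables (R : realType) (A : cstarAlgType R) (E : hilbertModType A).
Variables (Q : 'L(E)).
Hypothesis QQ : is_idempotent Q.
Let CS := @hilbert_cauchy_schwarz _ _ E.

(** Witnesses for the square root and the inverses are built in ['L(E)] and compressed to the range
    of [Q]; their equations are checked after inflation, which is injective. *)
Lemma matched_data_exists : exists P B Y G,
  matched_data Q P B Y G /\ matched_matrix Q = matched_value Q P Y G.
Proof.
rewrite /matched_matrix.
have [[PP Ps] PQ QP] := range_projP QQ.
set P := range_proj Q in PP Ps PQ QP *.
set RQ := ran_op Q; set NQ := nul_op Q^†.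
set U1 : 'L(E, RQ) := corestr RQ P.
set U2 : 'L(E, NQ) := corestr NQ (1 - P : 'L(E)).
set V : 'L(NQ, RQ) := corestr RQ (fun k : NQ => (Q - P) (\val k)).
set B : 'L(RQ) := op_sqrt (V \oL V^† + 1).
have PP' : P * P = P by [].
pose W := Q - P.
have PW : P * W = W by rewrite mulrBr PQ PP'.
have WP : W * P = 0 by rewrite mulrBl QP PP' subrr.
have PQs : P * Q^† = P by rewrite -{1}Ps -adjointM QP Ps.
have QsP : Q^† * P = Q^† by rewrite -{1}Ps -adjointM PQ.
have inRQ T : P * T = T -> forall x, sub_set RQ (T x).
  move=> PT x; exists (P (T x)) => //.
  rewrite -[LHS]/((Q * (P * T)) x); by rewrite mulrA QP PT.
have U1E x : \val (U1 x) = P x by apply: (@corestrE _ _ _ _ _ _ P) => //; exact: inRQ.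
have U2E x : \val (U2 x) = (1 - P) x.
  apply: (@corestrE _ _ _ _ _ _ (1 - P)) => // y.
  by rewrite -[sub_set _ _]/((Q^† * (1 - P)) y = 0) mulrBr mulr1 QsP subrr.
have fixRQ (y : RQ) : P (\val y) = \val y.
  have [u _ <-] : sub_set RQ (\val y) by apply/sub_predP; exact: valP.
  by rewrite -[LHS]/((P * Q) u) PQ.
have fixNQ (y : NQ) : (1 - P) (\val y) = \val y.
  have y0 : Q^† (\val y) = 0 by apply/(@sub_predP _ _ _ NQ); exact: valP.
  by rewrite -[LHS]/(\val y - P (\val y)) -PQs -[(P * _) _]/(P (Q^† _)) y0 adjop0 subr0.
(* The adjoints of [U1] and [U2] are the inclusions. *)
have U1s (y : RQ) : U1^† y = \val y.
  apply: ip_injr => x; rewrite -adjopP -[LHS]/(ip (\val (U1 x)) (\val y)) U1E.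
  by rewrite adjopP -[adjop_adj P]/(adjop_fun P^†) Ps fixRQ.
have U2s (y : NQ) : U2^† y = \val y.
  apply: ip_injr => x; rewrite -adjopP -[LHS]/(ip (\val (U2 x)) (\val y)) U2E.
  by rewrite adjopP -[adjop_adj _]/(adjop_fun (1 - P)^†) adjointB adjoint1 Ps fixNQ.
have VE k : \val (V k) = W (\val k).
  apply: (@corestrE _ _ _ _ _ _ (W \oL U2^†)) => [y|y]; first by rewrite -[RHS]/(W (U2^† y)) U2s.
  by apply: inRQ.
have UU1 : U1 \oL U1^† = 1.
  by apply: adjop_ext => y; apply: val_inj; rewrite -[val _]/(val (U1 (U1^† y))) U1E U1s fixRQ.
have UUP : U1^† \oL U1 = P by apply: adjop_ext => x; rewrite -[LHS]/(U1^† (U1 x)) U1s U1E.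
(* This relation and its adjoint trade [V] for [W], which acts on the whole module. *)
have VU2 : V \oL U2 = U1 \oL W.
  apply: adjop_ext => x; apply: val_inj.
  rewrite -[LHS]/(val (V (U2 x))) -[RHS]/(val (U1 (W x))) VE U1E U2E.
  rewrite -[LHS]/((W * (1 - P)) x) mulrBr WP mulr1 subr0.
  by rewrite -[RHS]/((P * W) x) PW.
have U1V : U1^† \oL V = W \oL U2^†.
  by apply: adjop_ext => x; rewrite -[LHS]/(U1^† (V x)) -[RHS]/(W (U2^† x)) U1s VE U2s.
have UU2 : U2^† \oL U2 = 1 - P by apply: adjop_ext => x; rewrite -[LHS]/(U2^† (U2 x)) U2s U2E.
have U2V : U2^† \oL V^† = W^† \oL U1^† by rewrite -!adjoint_comp VU2.
pose inf := inflate U1; pose com := compress U1.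
have infM T T' : inf (T * T') = inf T * inf T' by exact: inflateM.
have infD T T' : inf (T + T') = inf T + inf T' by exact: inflateD.
have inf1 : inf 1 = P by exact: inflate1.
have infI : injective inf by exact: inflate_inj.
have infC K : P * K = K * P -> inf (com K) = P * K.
  by move=> PK; rewrite [LHS](inflate_compress UUP) -mulrA -PK mulrA PP'.
have Pinf T : P * inf T = inf T by exact: mul_inflate.
have infP T : inf T * P = inf T by exact: inflate_mul.
have WW : W * W^† + P = Q * Q^†.
  rewrite /W adjointB Ps.
  transitivity (Q * Q^† - Q * P - P * Q^† + P * P + P); first by nc.
  by rewrite QP PQs PP'; nc.
have infT : inf (V \oL V^† + 1) = Q * Q^†.
  rewrite infD inf1 -WW; congr (_ + _).
  transitivity ((W \oL U2^†) \oL (W \oL U2^†)^†); first by rewrite -U1V; exact: adjop_ext.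
  transitivity (W * (U2^† \oL U2) * W^†); first exact: adjop_ext.
  by rewrite UU2 mulrBr WP subr0 mulr1.
have PQQ : P * (Q * Q^†) = Q * Q^† * P.
  by rewrite mulrA PQ -mulrA QsP.
have [Bpos BB] : op_positive B /\ B * B = V \oL V^† + 1.
  have := pos_gram CS (Q^†); rewrite adjointK => pQQ.
  (* The root [c] of [Q Q^†] commutes with [P], so it compresses to a root; its own root [k] gives
     the factorization required by [op_positive]. *)
  have [c [pc cc cC]] := pos_sqrt CS pQQ.
  have Pc : P * c = c * P by exact: cC.
  have [k [[ks _] kk kC]] := pos_sqrt CS pc.
  have Pk : P * k = k * P by exact: kC.
  apply: (@op_sqrtP _ _ _ _ (com c)).
    exists (com k); apply: infI; rewrite infM.
    rewrite [inf (_^†)]inflate_adjoint -[inflate U1 _]/(inf (com k)) !infC //.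
    by rewrite adjointM ks Ps -mulrA (mulrA P P) PP' {1}Pk -kk !mulrA Pk -!mulrA Pk.
  apply: infI; rewrite infT infM !infC // {1}Pc -mulrA (mulrA P P) PP' Pc !mulrA cc.
  by rewrite -PQQ mulrA PQ.
have iBB : inf B * inf B = Q * Q^† by rewrite -infM BB infT.
(* In the corner of [P], [Q Q^†] agrees with [1 + W W^†], which is invertible in ['L(E)]; the
   compressed inverse inverts [B * B]. *)
have [K [KM MK]] := pos_inverse CS (pos_gram CS (W^†)).
rewrite adjointK in KM MK.
have PM : P * (1 + W * W^†) = Q * Q^† by rewrite mulrDr mulr1 mulrA PW addrC.
have MP : (1 + W * W^†) * P = Q * Q^†.
  by rewrite mulrDl mul1r -mulrA -[W^† * P]adjointK adjointM Ps adjointK PW addrC.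
have PK : P * K = K * P.
  by apply: commute_inverse KM MK _; rewrite PM MP.
have [BiB BBi] : op_inv B * B = 1 /\ B * op_inv B = 1.
  have [] := @inverse_of_square _ B (com K).
  - by apply: infI; rewrite infM BB infT inf1 infC // -MP -!mulrA (mulrA K) KM mul1r.
  - by apply: infI; rewrite infM BB infT inf1 infC // -PM PK -!mulrA (mulrA _ K) MK mul1r.
  exact: op_invP.
have [S BS] := Bpos.
have iBS : inf B = (inf S)^† * inf S by rewrite BS infM [inf (_^†)]inflate_adjoint.
(* Likewise [B + 1] is inverted through [1 + inf B]. *)
have [L [LN NL]] := pos_inverse CS (pos_gram CS (inf S)).
rewrite -iBS in LN NL.
have PN : P * (1 + inf B) = inf B + P by rewrite mulrDr mulr1 Pinf addrC.
have NP : (1 + inf B) * P = inf B + P by rewrite mulrDl mul1r infP addrC.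
have PL : P * L = L * P by apply: commute_inverse LN NL _; rewrite PN NP.
have LB : com L * (B + 1) = 1.
  by apply: infI; rewrite infM infD inf1 infC // -NP -!mulrA (mulrA L) LN mul1r.
have BL : (B + 1) * com L = 1.
  by apply: infI; rewrite infM infD inf1 infC // -PN PL -!mulrA (mulrA _ L) NL mul1r.
have [GB BG] : op_inv (B * (B + 1)) * (B * (B + 1)) = 1 /\
    B * (B + 1) * op_inv (B * (B + 1)) = 1.
  apply: (@op_invP _ _ _ _ (com L * op_inv B)).
    by rewrite -mulrA (mulrA _ B) BiB mul1r.
  by rewrite -mulrA (mulrA (B + 1)) BL mul1r.
set Bi := op_inv B in BiB BBi *; set G := op_inv _ in GB BG *.
exists P, (inf B), (inf Bi), (inf G); split.
  split => //.
  - exact: inflate_positive.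
  - by rewrite -infM BiB inf1.
  - by rewrite -infM BBi inf1.
  - by rewrite -inf1 -infD -!infM GB inf1.
  - by rewrite -inf1 -infD -!infM BG inf1.
rewrite /block_conj /matched_value -/W !comp_opZl -!scalerDr !comp_opZr -!scalerDr.
congr (_ *: _).
(* The entries yield in turn [P + Y], [Y W], [W^† Y] and [W^† G W]. *)
rewrite !comp_opDr addrA; congr (_ + _ + _ + _).
- rewrite -[LHS]/(U1^† \oL (((B + 1) * Bi) \oL U1)) comp_opA -[LHS]/(inf ((B + 1) * Bi)).
  by rewrite mulrDl BBi mul1r infD inf1.
- by rewrite -comp_opA VU2; exact: adjop_ext.
- by rewrite !comp_opA U2V; exact: adjop_ext.
- rewrite -[LHS]/(U2^† \oL ((V^† \oL G \oL V) \oL U2)).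
  transitivity ((U2^† \oL V^†) \oL G \oL (V \oL U2)); first exact: adjop_ext.
  by rewrite U2V VU2; exact: adjop_ext.
Qed.

Lemma matched_projE : exists P B Y G,
  matched_data Q P B Y G /\ matched_proj Q = matched_value Q P Y G.
Proof.
rewrite /matched_proj; case: asboolP => [/matched_data_projection[d e]|_].
  by exists Q, Q, Q, (2^-1 *: Q); split.
exact: matched_data_exists.
Qed.

End Existence.

(** Each field is an identity in sums, products and adjoints, or a factorization [S^† * S], and all
    of these pass through [f]. *)
Lemma matched_data_morph (R : realType) (A A' : cstarAlgType R)
    (E : ipModType A) (F : ipModType A') (f : {rmorphism 'L(E) -> 'L(F)})
    (Q P B Y G : 'L(E)) :
  (forall T, f (T^†) = (f T)^†) ->
  matched_data Q P B Y G -> matched_data (f Q) (f P) (f B) (f Y) (f G).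
Proof.
move=> fs [? Ps ? ? [S BS] ? ? ? ? ? ? ? ? ? ?].
split; rewrite -?fs -?rmorphD -?rmorphM ?Ps; do ?by congr (f _).
by exists (f S); rewrite -fs -rmorphM -BS.
Qed.

Theorem theorem3p6 (R : realType) (A : cstarAlgType R) (H : hilbertModType A)
    (X : hilbertType R) (pi : {rmorphism 'L(H) -> 'L(X)})
    (pi_scalable : forall (k : R[i]) (T : 'L(H)), pi (k *: T) = k *: pi T)
    (pi_star : forall T : 'L(H), pi (T^†) = (pi T)^†)
    (Q : 'L(H)) (Q_idempotent : is_idempotent Q) :
  matched_proj (pi Q) = pi (matched_proj Q).
Proof.
have piQ : is_idempotent (pi Q) by rewrite /is_idempotent -rmorphM Q_idempotent.
have [P [B [Y [G [d ->]]]]] := matched_projE Q_idempotent.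
have [P' [B' [Y' [G' [d' ->]]]]] := matched_projE piQ.
rewrite (matched_value_unique d' (matched_data_morph pi_star d)) /matched_value.
by rewrite pi_scalable !rmorphD !rmorphM pi_star rmorphB.
Qed.
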